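(* Let $m\ge2$, $n\ge2$ be integers. For $\nu\in\{0,1\}$ and $\kappa\in\{1,2\}$ let $u_{\nu,\kappa}(m,n)$ be the number of threshold functions $g$ on $E_m\times E_n$ with $|T(g)|=3$, $g(0,0)=\nu$, and such that $T(g)$ consists of exactly $\kappa$ zeros of $g$ and $3-\kappa$ ones of $g$. Then $$u_{0,1}(m,n)=u_{1,2}(m,n)=2 f_1(\tfrac m2,\tfrac n2)+2-s(m,n),$$ $$u_{0,2}(m,n)=u_{1,1}(m,n)=f_2(m,n)+2-2 f_1(\tfrac m2,\tfrac n2)+s(m,n).$$ Furthermore, for every $\nu\in\{0,1\}$, $\kappa\in\{1,2\}$ and $2\le m\le n$, $$u_{\nu,\kappa}(m,n)=\frac{3}{4\pi^2}(mn)^2+O(mn^2),$$ where the implied constant is absolute.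
   Context: Let $E_k=\{0,1,\dots,k-1\}$. A function $g:E_m\times E_n\to\{0,1\}$ is a threshold function if there exist real $a_0,a_1,a_2$ with $\{x\in E_m\times E_n: g(x)=0\}=\{(x_1,x_2)\in E_m\times E_n: a_1x_1+a_2x_2\le a_0\}$. A set $T\subseteq E_m\times E_n$ is teaching for a threshold function $g$ if for every other threshold function $h\ne g$ on $E_m\times E_n$ there is $x\in T$ with $g(x)\ne h(x)$; it is minimal if no proper subset is teaching. It is known that the minimal teaching set of $g$ is unique, denoted $T(g)$. For a positive integer $q$ and positive reals $a,b$, $$f_q(a,b)=\sum_{\substack{-a<i<a,\ -b<j<b\\ \gcd(i,j)=q}}(a-|i|)(b-|j|),$$ the sum over integers $i,j$. Also $s(m,n)$ is the number of pairs of integers $(i,j)$ with $0<i<m$, $0<j<n$, $\gcd(i,j)=1$. *)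

(* Defs.v *)
From mathcomp Require Import all_boot all_order all_algebra.
From mathcomp Require Import all_classical all_reals all_analysis.

Set Implicit Arguments.
Unset Strict Implicit.
Unset Printing Implicit Defensive.

Import Order.TTheory GRing.Theory Num.Theory.

Local Open Scope ring_scope.

(* E_m x E_n is 'I_m * 'I_n; the values 0 and 1 are false and true. *)
Notation binfun m n := {ffun 'I_m * 'I_n -> bool}.

Section Threshold.
Variables (R : realType) (m n : nat).
Implicit Types (g h : binfun m n) (T : {set 'I_m * 'I_n}).

Definition threshold g : Prop :=
  exists a0 a1 a2 : R, forall x : 'I_m * 'I_n,
    g x = false <-> a1 * (x.1 : nat)%:R + a2 * (x.2 : nat)%:R <= a0.

Definition teaching g T : Prop :=
  forall h, threshold h -> h <> g -> exists2 x, x \in T & g x <> h x.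

Definition minimal_teaching g T : Prop :=
  teaching g T /\ forall T', T' \proper T -> ~ teaching g T'.

(* T(g): the minimal teaching set. One always exists (see below), and it is
   unique when g is a threshold function; the default set0 is never used. *)
Definition teaching_set g : {set 'I_m * 'I_n} :=
  odflt finset.set0 [pick T | `[< minimal_teaching g T >]].

Lemma teaching_setP g : minimal_teaching g (teaching_set g).
Proof.
rewrite /teaching_set; case: pickP => [T /asboolP // | noT].
have tT : `[< teaching g [set: 'I_m * 'I_n] >].
  apply/asboolP => h _ nhg; apply: contra_notP nhg => H.
  apply/ffunP => x; apply/eqP; apply: contra_notT H => /eqP nx.
  by exists x; [rewrite inE | move=> e; apply: nx].
have [T /minsetP [/asboolP tT' minT] _] :=
  minset_exists (P := fun T => `[< teaching g T >]) tT.
have /asboolP[] := noT T; split=> // T' /properP[sT'T [x xT xT']].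
move=> tT2; have e := minT T' (asboolT tT2) sT'T.
by rewrite e xT in xT'.
Qed.

(* The origin is described by its coordinates, since 'I_m and 'I_n have no
   canonical zero for arbitrary m and n. *)
Definition u_pred (nu : bool) (kappa : nat) g : Prop :=
  [/\ threshold g,
      #|teaching_set g| = 3%N,
      forall x : 'I_m * 'I_n, x.1 = 0%N :> nat -> x.2 = 0%N :> nat -> g x = nu,
      #|[set x in teaching_set g | g x == false]| = kappa &
      #|[set x in teaching_set g | g x == true]| = (3 - kappa)%N].

Definition u (nu : bool) (kappa : nat) : nat :=
  #|[set g : binfun m n | `[< u_pred nu kappa g >]]|.

End Threshold.

(* Finitely supported sum over a subset of Z x Z (a finite set for all a, b). *)
Definition f (R : realType) (q : nat) (a b : R) : R :=
  \sum_(p \in [set p : int * int |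
      [/\ - a < p.1%:~R < a, - b < p.2%:~R < b & gcdz p.1 p.2 = q%:Z]]%classic)
    (a - `|p.1%:~R|) * (b - `|p.2%:~R|).

Definition s (m n : nat) : nat :=
  #|[set p : 'I_m * 'I_n | [&& (0 < p.1)%N, (0 < p.2)%N & coprime p.1 p.2]]|.

(* Main.v *)
Require Import Defs.
From mathcomp Require Import all_boot all_order all_algebra.
From mathcomp Require Import all_classical all_reals all_analysis.
From mathcomp Require Import zify ring lra.

(* A teaching set made of one zero z and two ones o1, o2 determines its
   threshold function, and such triples are exactly the following ones: the
   lines z o1 and z o2 are consecutive among the lines joining z to other grid
   points, and o1, o2 are the grid points nearest to z on rays of the two
   lines bounding the same cone.  The triangle z o1 o2 is then unimodular,
   because the grid is a rectangle.

   Fix z, let P be the set of primitive vectors v with z + v in the grid, and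
   let sigma be the counterclockwise successor in the union Q of P and -P.
   The triples at z correspond to the d in Q with d in P and -sigma(d) in P.
   Summing the identity p q + 1 = (1 - p)(1 - q) + p + q over d, with
   p = [d in P] and q = [-sigma(d) in P], shows that their number is the
   number of v with v and -v in P, plus one if z is a corner of the grid.
   Summing over half of Q, cut along the direction from z to the origin,
   counts the triples whose function vanishes at the origin; the correction
   term is the number of rays from the origin, i.e. s(m,n) up to the axes.
   The sum over z of the number of v with z + v and z - v in the grid is
   4 f_1(m/2,n/2) = f_2(m,n).

   For the asymptotics, Moebius inversion reduces f_1 to sums over multiples;
   the absence of a logarithm in the error term comes from the boundedness of
   the partial sums of mu(d)/d, and the constant from zeta(2) = pi^2/6, which
   is obtained by iterating 4/sin(2x)^2 = 1/sin(x)^2 + 1/cos(x)^2. *)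

Set Implicit Arguments.
Unset Strict Implicit.
Unset Printing Implicit Defensive.

Import Order.TTheory GRing.Theory Num.Theory.
Import numFieldNormedType.Exports.

Local Open Scope ring_scope.

(** * Angular order of primitive vectors *)

Definition det (v w : int * int) : int := v.1 * w.2 - v.2 * w.1.

Definition prim (v : int * int) : bool := coprimez v.1 v.2.

Lemma detC v w : det v w = - det w v.
Proof. rewrite /det; ring. Qed.

Lemma detNl v w : det (- v) w = - det v w.
Proof. rewrite /det /=; ring. Qed.

Lemma detNr v w : det v (- w) = - det v w.
Proof. rewrite /det /=; ring. Qed.

Lemma det_refl v : det v v = 0.
Proof. rewrite /det; ring. Qed.

Lemma det_plucker v x y w :
  det v x * det y w = det v y * det x w + det v w * det y x.
Proof. rewrite /det; ring. Qed.

(** To the left of [v] the sign of [det] is a transitive order: multiply by [det v x] and apply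
    [det_plucker] (the three-term Pluecker relation), whose right side is then a sum of positive
    terms. *)
Lemma det_gt0_trans v y x w : 0 < det v y -> 0 < det v x -> 0 < det v w ->
  0 < det y x -> 0 < det x w -> 0 < det y w.
Proof.
move=> vy vx vw yx xw; rewrite -(pmulr_rgt0 _ vx) det_plucker.
by rewrite addr_gt0 // mulr_gt0.
Qed.

Lemma primN v : prim (- v) = prim v.
Proof. by rewrite /prim /= coprimezN coprimeNz. Qed.

Lemma prim_dvd v w : prim v -> det v w = 0 -> (v.1 %| w.1)%Z && (v.2 %| w.2)%Z.
Proof.
rewrite /prim /det => pv /eqP; rewrite subr_eq0 => /eqP e.
apply/andP; split.
  by rewrite -(Gauss_dvdzr _ pv) -e dvdz_mulr.
by rewrite coprimez_sym in pv; rewrite -(Gauss_dvdzr _ pv) e dvdz_mulr.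
Qed.

(** Divisibility in both directions makes the coordinates equal up to sign; as [det v w = 0], mixed
    signs can occur only when a coordinate is zero. *)
Lemma prim_collinear v w : prim v -> prim w -> det v w = 0 -> w = v \/ w = - v.
Proof.
move=> pv pw e; have /andP[a1 a2] := prim_dvd pv e.
have /andP[b1 b2] : (w.1 %| v.1)%Z && (w.2 %| v.2)%Z.
  by apply: prim_dvd => //; rewrite detC e oppr0.
have e1 : `|v.1|%N = `|w.1|%N by apply/eqP; rewrite eqn_dvd; apply/andP; split.
have e2 : `|v.2|%N = `|w.2|%N by apply/eqP; rewrite eqn_dvd; apply/andP; split.
move: e e1 e2 pv; case: v {pw a1 a2 b1 b2} => v1 v2; case: w => w1 w2 /=.
rewrite /det /prim /= => e e1 e2 pv.
have [E1|E1] : w1 = v1 \/ w1 = - v1 by lia.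
  have [E2|E2] : w2 = v2 \/ w2 = - v2 by lia.
    by left; rewrite E1 E2.
  have [z|z] : v1 = 0 \/ v2 = 0 by subst; nia.
    by right; rewrite E1 E2 z; congr pair; rewrite ?oppr0.
  by left; rewrite E1 E2 z oppr0.
have [E2|E2] : w2 = v2 \/ w2 = - v2 by lia.
  have [z|z] : v1 = 0 \/ v2 = 0 by subst; nia.
    by left; rewrite E1 E2 z oppr0.
  by right; rewrite E1 E2 z; congr pair; rewrite ?oppr0.
by right; rewrite E1 E2.
Qed.

Lemma prim_neq_opp v : prim v -> v <> - v.
Proof.
case: v => a b pv [] e1 e2; move: pv; rewrite /prim.
have -> : a = 0 by lia.
by have -> : b = 0 by lia.
Qed.

Section Angular.

(** [W] is a finite encoding of vectors and [opp] is negation. Symmetry of [Q] together with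
    [Q_span] ensures that from each direction another one is reached in less than half a turn. *)
Variables (W : finType) (vec : W -> int * int) (opp : W -> W).
Hypotheses (vec_inj : injective vec) (vec_opp : forall t, vec (opp t) = - vec t).
Variable Q : {set W}.
Hypotheses (Q_opp : forall t, t \in Q -> opp t \in Q)
           (Q_prim : forall t, t \in Q -> prim (vec t))
           (Q_span : forall t, t \in Q -> exists2 w, w \in Q & det (vec t) (vec w) != 0).

Let D s t := det (vec s) (vec t).

Lemma dir_oppK : involutive opp.
Proof. by move=> t; apply: vec_inj; rewrite !vec_opp opprK. Qed.

Lemma opp_mem t : (opp t \in Q) = (t \in Q).
Proof. by apply/idP/idP => /Q_opp //; rewrite dir_oppK. Qed.

Definition btw v x w := (0 < D v x) && (0 < D x w).

Definition isnext v w := [&& w \in Q, 0 < D v w & [forall x in Q, ~~ btw v x w]].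

Lemma isnextP v w : reflect [/\ w \in Q, 0 < D v w &
    forall x, x \in Q -> 0 < D v x -> 0 < D x w -> False] (isnext v w).
Proof.
apply: (iffP and3P) => -[wQ vw H]; split => //.
  by move=> x xQ vx xw; have /forall_inP/(_ x xQ) := H; rewrite /btw vx xw.
by apply/forall_inP => x xQ; apply/negP => /andP[vx xw]; exact: (H x).
Qed.

Lemma isnext_exists v : v \in Q -> exists w, isnext v w.
Proof.
move=> vQ; have [w0 w0Q vw0] : exists2 w, w \in Q & 0 < D v w.
  have [w wQ] := Q_span vQ; rewrite neq_lt => /orP[] h; last by exists w.
  by exists (opp w); [exact: Q_opp | rewrite /D vec_opp detNr oppr_gt0].
(* Minimise the number of directions strictly between [v] and [w]: a direction [x] left inside the
   cone would, by transitivity, have strictly fewer. *)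
pose S w := [set x in Q | btw v x w].
have i0 : (w0 \in Q) && (0 < D v w0) by rewrite w0Q.
case: (arg_minnP (P := fun w => (w \in Q) && (0 < D v w)) (fun w => #|S w|) i0).
move=> w /andP[wQ vw] wmin; exists w.
apply/isnextP; split => // x xQ vx xw.
have := wmin x; rewrite xQ vx => /(_ isT); apply/negP; rewrite -ltnNge.
apply: proper_card; apply/properP; split.
  apply/fintype.subsetP => y; rewrite !inE => /andP[-> /andP[vy yx]] /=.
  by rewrite /btw vy /=; exact: (det_gt0_trans vy vx vw yx xw).
by exists x; rewrite !inE xQ /btw vx ?xw //= /D det_refl.
Qed.

Lemma collinear_eq v w x : v \in Q -> w \in Q -> D v w = 0 ->
  0 < D v x -> 0 < D w x -> v = w.
Proof.
move=> vQ wQ e vx wx; apply: vec_inj.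
have [-> //|h] := prim_collinear (Q_prim vQ) (Q_prim wQ) e.
by move: wx; rewrite /D h detNl oppr_gt0 => /ltW/le_gtF; rewrite vx.
Qed.

(** Of two candidates that are not collinear, one lies strictly inside the cone of the other;
    collinear ones coincide because both are to the left of [v]. *)
Lemma isnext_uniq v w w' : isnext v w -> isnext v w' -> w = w'.
Proof.
move=> /isnextP[wQ vw H] /isnextP[w'Q vw' H'].
have e : D w w' = 0.
  case: (ltgtP (D w w') 0) => // h; exfalso.
    by apply: (H w') => //; rewrite /D detC oppr_gt0.
  by apply: (H' w).
apply: (@collinear_eq w w' (opp v)) => //.
  by rewrite /D vec_opp detNr -detC.
by rewrite /D vec_opp detNr -detC.
Qed.

(** For [v] in [Q] the default is never returned, by [isnext_exists]. *)
Definition succ_dir v := odflt v [pick w | isnext v w].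

Lemma nextP v : v \in Q -> isnext v (succ_dir v).
Proof.
move=> vQ; rewrite /succ_dir; case: pickP => //= h.
by have [w] := isnext_exists vQ; rewrite h.
Qed.

Lemma next_eq v w : v \in Q -> isnext v w -> succ_dir v = w.
Proof. by move=> vQ; apply: isnext_uniq; exact: nextP. Qed.

Lemma next_mem v : v \in Q -> succ_dir v \in Q.
Proof. by move=> /nextP/isnextP[]. Qed.

(** Mirror image of [isnext_uniq]: of two directions with the same successor, one would lie in the
    cone of the other. *)
Lemma next_inj : {in Q &, injective succ_dir}.
Proof.
move=> v v' vQ v'Q e.
have /isnextP[wQ vw H] := nextP vQ; have /isnextP[w'Q vw' H'] := nextP v'Q.
rewrite -e in vw' H'.
apply: (@collinear_eq v v' (succ_dir v)) => //.
case: (ltgtP (D v v') 0) => // h; exfalso.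
  by apply: (H' v) => //; rewrite /D detC oppr_gt0.
by apply: (H v').
Qed.

(** The half turn counterclockwise from the opposite of [c], which is included, to [c], which is
    not. *)
Definition half_dirs c := [set d in Q | (d == opp c) || (0 < D (opp c) d)].

Lemma mem_half c d :
  (d \in half_dirs c) = (d \in Q) && ((d == opp c) || (0 < D (opp c) d)).
Proof. by rewrite inE. Qed.

Lemma half_sub c : half_dirs c \subset Q.
Proof. by apply/fintype.subsetP => d; rewrite inE => /andP[]. Qed.

Lemma vec_neq_opp c : c \in Q -> c != opp c.
Proof.
by move=> cQ; apply/eqP => e; apply: (prim_neq_opp (Q_prim cQ)); rewrite -vec_opp -e.
Qed.

Lemma half_opp c d : c \in Q -> d \in Q -> (opp d \in half_dirs c) = (d \notin half_dirs c).
Proof.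
move=> cQ dQ; rewrite !inE dQ opp_mem dQ /= (inj_eq (can_inj dir_oppK)).
rewrite {1}/D (vec_opp d) detNr oppr_gt0 negb_or -leNgt.
have := vec_neq_opp cQ.
case: (ltgtP (D (opp c) d) 0) => h.
- move=> _; rewrite /= orbT andbT; apply/esym/eqP => e.
  by move: h; rewrite e /D det_refl ltxx.
- move=> _; rewrite /= andbF orbF; apply/eqP => e.
  by move: h; rewrite e /D vec_opp detNl det_refl oppr0 ltxx.
- have [|e|e] := prim_collinear (Q_prim (Q_opp cQ)) (Q_prim dQ).
  + by rewrite -h.
  + have -> : d = opp c by apply: vec_inj; rewrite e.
    by move=> cc; rewrite eqxx /= orbF eq_sym (negbTE cc).
  + have -> : d = c by apply: vec_inj; rewrite e -vec_opp dir_oppK.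
    by move=> cc; rewrite eqxx /= cc.
Qed.

(** The successor moves the half turn on by one step: its first element [opp c] is lost and [c] is
    gained. Inclusion suffices, since the map is injective and the right side is no larger than the
    half turn. *)
Lemma next_half c : c \in Q -> succ_dir @: half_dirs c = c |: (half_dirs c :\ opp c).
Proof.
move=> cQ; apply/eqP; rewrite eqEcard; apply/andP; split.
  apply/fintype.subsetP => _ /imsetP[d dH ->].
  have dQ := fintype.subsetP (half_sub c) _ dH.
  have /isnextP[wQ dw H] := nextP dQ.
  move: dH; rewrite inE dQ => /orP[/eqP E|cd].
    rewrite !inE wQ -E dw orbT /= andbT; apply/orP; right; apply/eqP => e.
    by move: dw; rewrite e /D det_refl ltxx.
  have nc : succ_dir d != opp c.
    apply/eqP => e; move: dw; rewrite e /D detC oppr_gt0.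
    by move/ltW/le_gtF; rewrite /D in cd; rewrite cd.
  rewrite !inE (negbTE nc) wQ /=.
  case: (ltgtP (D (opp c) (succ_dir d)) 0) => h; rewrite ?orbT //=.
    exfalso; apply: (H c) => //.
      by move: cd; rewrite /D vec_opp detNl -detC.
    by move: h; rewrite /D vec_opp detNl oppr_lt0.
  have [|e|e] := prim_collinear (Q_prim (Q_opp cQ)) (Q_prim wQ).
  + by rewrite -h.
  + by case/eqP: nc; apply: vec_inj; rewrite e.
  + by rewrite orbF; apply/eqP; apply: vec_inj; rewrite e -vec_opp dir_oppK.
rewrite card_in_imset; last first.
  by move=> x y xH yH; apply: next_inj; apply: (fintype.subsetP (half_sub c)).
have ocH : opp c \in half_dirs c by rewrite inE Q_opp // eqxx.
by rewrite cardsU1 (cardsD1 (opp c) (half_dirs c)) ocH leq_add2r leq_b1.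
Qed.

Variable P : {set W}.
Hypothesis QP : forall t, (t \in Q) = (t \in P) || (opp t \in P).

(** With p = [d in P] and q = [-succ d in P], [conf] collects the d with p q = 1 and [flip] those
    with (1 - p)(1 - q) = 1. *)
Definition conf (A : {set W}) := [set d in A | (d \in P) && (opp (succ_dir d) \in P)].
Definition flip (A : {set W}) := [set d in A | (d \notin P) && (opp (succ_dir d) \notin P)].
Definition bidir := [set d | (d \in P) && (opp d \in P)].

Lemma mem_conf (A : {set W}) d :
  (d \in conf A) = [&& d \in A, d \in P & opp (succ_dir d) \in P].
Proof. by rewrite inE. Qed.

Lemma mem_flip (A : {set W}) d :
  (d \in flip A) = [&& d \in A, d \notin P & opp (succ_dir d) \notin P].
Proof. by rewrite inE. Qed.

Lemma mem_bidir d : (d \in bidir) = (d \in P) && (opp d \in P).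
Proof. by rewrite inE. Qed.

(** The identity p q + 1 = (1 - p)(1 - q) + p + q summed over [A]; injectivity of the successor
    turns the sum of q into a count over the image of [A]. *)
Lemma card_conf (A : {set W}) : A \subset Q ->
  (#|conf A| + #|A| = #|flip A| + #|A :&: P| + #|[set d in succ_dir @: A | opp d \in P]|)%N.
Proof.
move=> AQ.
have cardS (p : pred W) : #|[set d in A | p d]| = (\sum_(d in A) p d)%N.
  rewrite -sum1_card big_mkcond /= [RHS]big_mkcond /=; apply: eq_bigr => d _.
  by rewrite inE; case: (d \in A); case: (p d).
have -> : #|[set d in succ_dir @: A | opp d \in P]| = (\sum_(d in A) (opp (succ_dir d) \in P))%N.
  rewrite -(big_imset (fun d => (opp d \in P) : nat)) /=; last first.
    by move=> x y xA yA; apply: next_inj; exact: (fintype.subsetP AQ).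
  rewrite -sum1_card big_mkcond /= [RHS]big_mkcond /=; apply: eq_bigr => d _.
  by rewrite inE; case: (d \in _); case: (opp d \in P).
rewrite !cardS -sum1_card -!big_split /=; apply: eq_bigr => d _.
by case: (d \in P); case: (opp _ \in P).
Qed.

Lemma card_opp (p : pred W) : #|[set d | p (opp d)]| = #|[set d | p d]|.
Proof.
rewrite -(card_imset [set d | p d] (can_inj dir_oppK)); apply: eq_card => d.
rewrite !inE; apply/idP/imsetP => [pd|[e]]; last by rewrite inE => pe ->; rewrite dir_oppK.
by exists (opp d); rewrite ?inE ?dir_oppK.
Qed.

Lemma PsubQ : P \subset Q.
Proof. by apply/fintype.subsetP => t tP; rewrite QP tP. Qed.

(** Inclusion-exclusion for P and -P, with union [Q] and intersection [bidir]. *)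
Lemma card_bidir : (#|Q| + #|bidir| = 2 * #|P|)%N.
Proof.
have -> : Q = P :|: [set d | opp d \in P].
  by apply/finset.setP => d; rewrite !inE QP.
have -> : bidir = P :&: [set d | opp d \in P].
  by apply/finset.setP => d; rewrite !inE.
by rewrite cardsUI (card_opp (fun d => d \in P)) cardsE mul2n addnn.
Qed.

(** On all of [Q] the successor is a permutation, so p and q both sum to [#|P|]; then [card_bidir]
    eliminates [#|Q|]. *)
Lemma card_conf_full : #|conf Q| = (#|flip Q| + #|bidir|)%N.
Proof.
have := card_conf (subxx Q).
have -> : succ_dir @: Q = Q.
  apply/eqP; rewrite eqEcard card_in_imset ?leqnn ?andbT; last exact: next_inj.
  by apply/fintype.subsetP => _ /imsetP[d dQ ->]; exact: next_mem.
have -> : [set d in Q | opp d \in P] = [set d | opp d \in P].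
  by apply/finset.setP => d; rewrite !inE; apply: andb_idl => h; rewrite QP h orbT.
rewrite (card_opp (fun d => d \in P)) cardsE (finset.setIidPr PsubQ).
have := card_bidir; lia.
Qed.

(** Effect of the shift in [next_half]: the lost element was counted because [c] is in [P], and the
    gained one counts when [opp c] is in [P]. *)
Lemma card_shift (H : {set W}) c : opp c \in H -> c \notin H -> c \in P ->
  #|[set d in c |: (H :\ opp c) | opp d \in P]| =
    ((opp c \in P) + #|[set d in H | opp d \in P]| - 1)%N.
Proof.
move=> ocH cH cP.
have inS (A : {set W}) (p : pred W) d : (d \in [set e in A | p e]) = (d \in A) && p d.
  by rewrite inE.
have -> : [set d in H | opp d \in P] =
   opp c |: [set d in H :\ opp c | opp d \in P].
  apply/finset.setP => d; rewrite [RHS] finset.in_setU1 !inS finset.in_setD1.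
  by have [->|_] := eqVneq d (opp c); rewrite /= ?ocH ?dir_oppK ?cP.
rewrite cardsU1 inS finset.in_setD1 eqxx /= addnCA addKn.
have [oP|oP] := boolP (opp c \in P).
  have -> : [set d in c |: H :\ opp c | opp d \in P] =
     c |: [set d in H :\ opp c | opp d \in P].
    apply/finset.setP => d; rewrite [RHS] finset.in_setU1 !inS finset.in_setU1 finset.in_setD1.
    by have [->|_] := eqVneq d c; rewrite /= ?oP.
  by rewrite cardsU1 inS finset.in_setD1 (negbTE cH) andbF.
congr #|pred_of_set _|; apply/finset.setP => d; rewrite !inS finset.in_setU1 finset.in_setD1.
by have [->|_] := eqVneq d c; rewrite /= ?(negbTE oP) ?andbF.
Qed.

(** Negation exchanges the half turn with its complement in [Q]. Hence the half turn is half of [Q],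
    and its elements in P and in -P number [#|P|] together. The terms 2 and [opp c \in P] come from
    the shift. *)
Lemma card_conf_half c : c \in P ->
  (2 * #|conf (half_dirs c)| + 2 = 2 * #|flip (half_dirs c)| + #|bidir| + 2 * (opp c \in P))%N.
Proof.
move=> cP; have cQ : c \in Q by rewrite QP cP.
have inS (A : {set W}) (p : pred W) d : (d \in [set e in A | p e]) = (d \in A) && p d.
  by rewrite inE.
have := card_conf (half_sub c); rewrite next_half //.
have ocH : opp c \in half_dirs c by rewrite inE Q_opp // eqxx.
have cH : c \notin half_dirs c by rewrite -half_opp.
rewrite card_shift //.
have cHQ : (#|half_dirs c| + #|half_dirs c| = #|Q|)%N.
  rewrite -(cardsID (half_dirs c) Q) (finset.setIidPr (half_sub c)); congr (_ + _)%N.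
  rewrite -(card_imset (half_dirs c) (can_inj dir_oppK)); apply: eq_card => d.
  rewrite finset.in_setD; apply/imsetP/idP => [[e eH ->]|/andP[dH dQ]].
    have eQ := fintype.subsetP (half_sub c) _ eH.
    by rewrite half_opp // negbK eH opp_mem.
  by exists (opp d); rewrite ?dir_oppK // half_opp.
have cHP : (#|half_dirs c :&: P| + #|[set d in half_dirs c | opp d \in P]| = #|P|)%N.
  rewrite -(cardsID (half_dirs c) P) finset.setIC; congr (_ + _)%N.
  rewrite -(card_imset _ (can_inj dir_oppK)); apply: eq_card => d.
  rewrite finset.in_setD; apply/imsetP/idP => [[e]|/andP[dH dP]].
    rewrite inS => /andP[eH eP] ->.
    have eQ := fintype.subsetP (half_sub c) _ eH.
    by rewrite eP andbT half_opp // negbK.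
  exists (opp d); rewrite ?dir_oppK // inS half_opp ?dir_oppK ?dP ?andbT //.
  by rewrite QP dP.
(* Makes the truncated subtraction in [card_shift] exact. *)
have p1 : (0 < #|[set d in half_dirs c | opp d \in P]|)%N.
  by apply/card_gt0P; exists (opp c); rewrite inS ocH dir_oppK.
have := card_bidir; lia.
Qed.

End Angular.

(** * Lattice points seen from a point of a box *)

Definition inbox (m n : nat) (x : int * int) : bool :=
  (0 <= x.1 < m%:Z) && (0 <= x.2 < n%:Z).

Lemma primitive_part x : x != 0 ->
  exists g y, [/\ 0 < g, prim y & x = (g * y.1, g * y.2)].
Proof.
case: x => a b nz; pose g := gcdz a b.
have g0 : 0 < g.
  rewrite lt_neqAle eq_sym gcdz_eq0 negb_and; apply/andP; split; last by [].
  by move: nz; rewrite -pair_eqE /= negb_and.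
have /dvdzP[c ec] := dvdz_gcdl a b; have /dvdzP[d ed] := dvdz_gcdr a b.
rewrite -/g in ec ed; exists g, (c, d); split => //=; last by rewrite ec ed !(mulrC g).
rewrite /prim /coprimez /=; apply/eqP; apply: (mulfI (lt0r_neq0 g0)).
by rewrite mulr1 -[in LHS](gtz0_abs g0) mulz_gcdr (mulrC g) (mulrC g) -ec -ed.
Qed.

Lemma det_cramer v u w :
  det v w * u.1 = det u w * v.1 + det v u * w.1 /\
  det v w * u.2 = det u w * v.2 + det v u * w.2.
Proof. rewrite /det; split; ring. Qed.

(** A Bezout vector u with [det v u = 1] is free up to multiples of [v]; reducing [det u w] modulo
    [det v w] moves it into the cone. The two equations are Cramer's rule. *)
Lemma between_lattice v w : prim v -> prim w -> 1 < det v w ->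
  exists u, [/\ det v u = 1, 0 < det u w < det v w,
    det v w * u.1 = det u w * v.1 + w.1 & det v w * u.2 = det u w * v.2 + w.2].
Proof.
case: v w => v1 v2 [w1 w2]; rewrite /prim /= => pv pw D1.
have [[a b]] := coprimezP _ _ pv; rewrite /= => ab.
set D := det _ _ in D1 *.
pose k0 := det (- b, a) (w1, w2).
have D0 : D != 0 by lia.
pose q := (k0 %/ D)%Z; pose u : int * int := (- b - q * v1, a - q * v2).
have vu : det (v1, v2) u = 1 by rewrite /det /u /=; nia.
have uw : det u (w1, w2) = (k0 %% D)%Z.
  have -> : (k0 %% D)%Z = k0 - q * D by rewrite [k0 in RHS](divz_eq k0 D) -/q; ring.
  by rewrite /k0 /D /det /u /=; ring.
have E1 : D * u.1 = det u (w1, w2) * v1 + w1.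
  by have [-> _] := det_cramer (v1, v2) u (w1, w2); rewrite vu mul1r.
have E2 : D * u.2 = det u (w1, w2) * v2 + w2.
  by have [_ ->] := det_cramer (v1, v2) u (w1, w2); rewrite vu mul1r.
exists u; split => //=.
rewrite uw ltz_pmod ?andbT; last by lia.
(* If [det u w] vanished, [w] would be D times [u] with D > 1, hence not primitive. *)
rewrite lt_neqAle modz_ge0 // andbT eq_sym; apply/eqP => e.
rewrite uw e !mul0r !add0r in E1 E2.
move: pw; rewrite /coprimez -E1 -E2 -mulz_gcdr gtz0_abs; last by lia.
move/eqP; move: (gcdz _ _) => g; clear -D1; case: (leP g 0) => g0; nia.
Qed.

(** Otherwise [between_lattice] gives u in the cone, with z + u and z - u both outside the box. One
    coordinate cannot account for both; if two different ones do, u exceeds v in one and v exceeds u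
    in the other, and [det v u] has absolute value at least 2. *)
Lemma unimodular_next m n z v w : prim v -> prim w -> 0 < det v w ->
  inbox m n z -> inbox m n (z + v) -> inbox m n (z - w) ->
  (forall x, 0 < det v x -> 0 < det x w -> ~~ inbox m n (z + x) && ~~ inbox m n (z - x)) ->
  det v w = 1.
Proof.
move=> pv pw D0 bz bv bw H; apply/eqP; apply: contraT => D1.
have {}D0 : 1 < det v w by lia.
have [u [vu /andP[k0 kD] E1 E2]] := between_lattice pv pw D0.
have := H u; rewrite vu => /(_ isT k0) /andP[].
move: vu k0 kD E1 E2 bz bv bw D0; move: (det v w) (det u w) => D k.
case: z v w u {pv pw H D1} => z1 z2 [v1 v2] [w1 w2] [u1 u2].
rewrite /inbox /det /= => vu k0 kD E1 E2 bz bv bw D0.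
(* A coordinate in which [z + u] leaves the box has [v] on the near side of [u];
   a coordinate in which [z - u] leaves it has [v] on the far side. *)
have coord (M a c d x : int) : D * x = k * c + d -> 0 <= a < M -> 0 <= a + c < M ->
    0 <= a - d < M -> (~~ (0 <= a + x < M) -> 0 < x /\ c < x \/ x < 0 /\ x < c) /\
    (~~ (0 <= a - x < M) -> 0 < x /\ x < c \/ x < 0 /\ c < x).
  clear -k0 kD => e h1 h2 h3; split=> h; first by lia.
  have [xp|xn] : x > 0 \/ x < 0 by lia.
    have : k * x < k * c.
      have : k * x + x <= D * x by nia.
      by lia.
    by rewrite ltr_pM2l // => ?; left.
  have : k * c < k * x.
    have : D * x <= k * x + x by nia.
    by lia.
  by rewrite ltr_pM2l // => ?; right.
move: bz bv bw => /andP[h1 h2] /andP[h3 h4] /andP[h5 h6].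
have [a1 b1] := coord _ _ _ _ _ E1 h1 h3 h5.
have [a2 b2] := coord _ _ _ _ _ E2 h2 h4 h6.
clear - vu a1 a2 b1 b2.
move=> /nandP[/a1 p1|/a2 p1] /nandP[/b1 p2|/b2 p2]; clear - vu p1 p2.
- by lia.
- by case: p1 => -[? ?]; case: p2 => -[? ?]; nia.
- by case: p1 => -[? ?]; case: p2 => -[? ?]; nia.
- by lia.
Qed.

(** Here (i, j) is (k (a, b) + (c, d)) / D. As k + 1 <= D, each coordinate is at most the larger of
    the two it is combined from. *)
Lemma flip_bounds (a b c d i j k D : int) : 0 < a -> 0 < b -> 0 < c -> 0 < d ->
  c < a -> b < d -> 0 < k < D -> D * i = k * a + c -> D * j = k * b + d ->
  [/\ 0 < i, i <= a, 0 < j & j <= d].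
Proof.
move=> a0 b0 c0 d0 ca bd /andP[k0 kD] ei ej.
have D0 : 0 < D by lia.
split.
- by rewrite -(pmulr_rgt0 _ D0) ei addr_gt0 // mulr_gt0.
- by rewrite -(ler_pM2l D0) ei; clear -kD ca a0; nia.
- by rewrite -(pmulr_rgt0 _ D0) ej addr_gt0 // mulr_gt0.
- by rewrite -(ler_pM2l D0) ej; clear -kD bd d0 k0; nia.
Qed.

Lemma flip_sign (k D x c d : int) : 0 < k < D -> D * x = k * c + d ->
  0 < c /\ 0 < d \/ c < 0 /\ d < 0 ->
  D * `|x| = k * `|c| + `|d| /\ (0 < x /\ 0 < c \/ x < 0 /\ c < 0).
Proof.
move=> /andP[k0 kD] e; have D0 : 0 < D by lia.
move=> [[c0 d0]|[c0 d0]].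
  have x0 : 0 < x by rewrite -(pmulr_rgt0 _ D0) e addr_gt0 // mulr_gt0.
  by rewrite !gtr0_norm //; split; [|left].
have x0 : x < 0 by rewrite -oppr_gt0 -(pmulr_rgt0 _ D0) mulrN e; nia.
by rewrite !ltr0_norm // !mulrN e opprD; split; [|right].
Qed.

(** The product |a j| exceeds |b i| by at least |a|, which is at least 2. *)
Lemma flip_det (a b i j : int) : 0 < a * i -> 0 < b * j -> 1 < `|i| ->
  `|i| <= `|a| -> `|b| < `|j| -> a * j - b * i != 1 /\ b * i - a * j != 1.
Proof.
move=> ai bj i1 ia bj'.
have K : `|b| * `|i| + `|a| <= `|a| * `|j|.
  have h1 : `|b| * `|i| <= `|b| * `|a| by rewrite ler_wpM2l.
  have h2 : `|a| * (`|b| + 1) <= `|a| * `|j| by rewrite ler_wpM2l //; lia.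
  by lia.
rewrite -!normrM in K; have : 1 < `|a * j| - `|b * i| by lia.
by lia.
Qed.

Definition opposite_nbrs m n z (e : int * int) := inbox m n (z + e) && inbox m n (z - e).

(** If both neighbours of z on an axis are in the box, that axis does not enter the open cone, and
    it does not bound it either, because z + v and z - w are outside. So v and w are strictly on one
    side of the axis. *)
Lemma axis_flip m n z v w : prim v -> prim w -> 0 < det v w ->
  ~~ inbox m n (z + v) -> ~~ inbox m n (z - w) ->
  (forall x, 0 < det v x -> 0 < det x w -> ~~ inbox m n (z + x) && ~~ inbox m n (z - x)) ->
  (opposite_nbrs m n z (1, 0) -> 0 < v.2 /\ 0 < w.2 \/ v.2 < 0 /\ w.2 < 0) /\
  (opposite_nbrs m n z (0, 1) -> 0 < v.1 /\ 0 < w.1 \/ v.1 < 0 /\ w.1 < 0).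
Proof.
have prim1 (a : int) : coprimez a 0 -> a = 1 \/ a = - 1.
  by rewrite /coprimez gcdz0 => /eqP; lia.
case: z v w => z1 z2 [v1 v2] [w1 w2]; rewrite /prim /= => pv pw D0 nv nw H.
split=> /andP[e1 e2].
  have h1 := H (1, 0); have h2 := H (- 1, 0).
  have v20 : v2 != 0.
    apply/eqP => E; move: pv nv; rewrite E => /prim1 [] ->.
      by move: e1; rewrite /inbox /= => ->.
    by move: e2; rewrite /inbox /= => ->.
  have w20 : w2 != 0.
    apply/eqP => E; move: pw nw; rewrite E => /prim1 [] ->.
      by move: e2; rewrite /inbox /= => ->.
    by move: e1; rewrite /inbox /= => ->.
  move: e1 e2 h1 h2 v20 w20; rewrite /inbox /det /=; clear => e1 e2 h1 h2 v20 w20.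
  by case: (ltgtP v2 0) v20 => // ? _; case: (ltgtP w2 0) w20 => // ? _; lia.
have h1 := H (0, 1); have h2 := H (0, - 1).
have v10 : v1 != 0.
  apply/eqP => E; move: pv nv; rewrite E coprimez_sym => /prim1 [] ->.
    by move: e1; rewrite /inbox /= => ->.
  by move: e2; rewrite /inbox /= => ->.
have w10 : w1 != 0.
  apply/eqP => E; move: pw nw; rewrite E coprimez_sym => /prim1 [] ->.
    by move: e2; rewrite /inbox /= => ->.
  by move: e1; rewrite /inbox /= => ->.
move: e1 e2 h1 h2 v10 w10; rewrite /inbox /det /=; clear => e1 e2 h1 h2 v20 w20.
by case: (ltgtP v1 0) v20 => // ? _; case: (ltgtP w1 0) w20 => // ? _; lia.
Qed.

(** This excludes [flip] away from the corners. The vectors v and w lie in one open quadrant, and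
    the box makes each longer than the other in one coordinate, so [det v w > 1]. The vector u of
    [between_lattice] is then too long for [det v u = 1]. *)
Lemma no_flip m n z v w : prim v -> prim w -> 0 < det v w -> inbox m n z ->
  inbox m n (z - v) -> inbox m n (z + w) -> ~~ inbox m n (z + v) -> ~~ inbox m n (z - w) ->
  (forall x, 0 < det v x -> 0 < det x w -> ~~ inbox m n (z + x) && ~~ inbox m n (z - x)) ->
  opposite_nbrs m n z (1, 0) || opposite_nbrs m n z (0, 1) -> False.
Proof.
move=> pv pw D0 bz bv bw nv nw H.
have [A1 A2] := axis_flip pv pw D0 nv nw H; move=> nb.
(* In the coordinate whose signs are settled first, z - v and z + w are on opposite sides of z. So z
   is interior in that coordinate too, and the other half of [axis_flip] applies. *)
have [S1 S2] : (0 < v.1 /\ 0 < w.1 \/ v.1 < 0 /\ w.1 < 0) /\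
    (0 < v.2 /\ 0 < w.2 \/ v.2 < 0 /\ w.2 < 0).
  case/orP: nb => nb.
    have h := A1 nb; split=> //; apply: A2; move: h bz bv bw; clear.
    by rewrite /opposite_nbrs /inbox /=; lia.
  have h := A2 nb; split=> //; apply: A1; move: h bz bv bw; clear.
  by rewrite /opposite_nbrs /inbox /=; lia.
clear A1 A2 nb.
have D1 : 1 < det v w.
  move: S1 S2 bz bv bw nv nw D0; clear.
  case: z v w => z1 z2 [v1 v2] [w1 w2]; rewrite /inbox /det /= => S1 S2 bz bv bw nv nw D0.
  have : (`|w1| < `|v1| /\ `|v2| < `|w2|) \/ (`|v1| < `|w1| /\ `|w2| < `|v2|) by lia.
  move: S1 S2 D0; clear.
  by move=> [] [? ?] [] [? ?] D0 [] [? ?]; nia.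
have [u [vu /andP[k0 kD] E1 E2]] := between_lattice pv pw D1.
have := H u; rewrite vu => /(_ isT k0) /andP[nu nu'].
have k0D : 0 < det u w < det v w by rewrite k0.
move: vu k0D E1 E2 S1 S2 bz bv bw nv nw nu nu'; clear.
set D := det v w; set k := det u w; rewrite /inbox.
have eD : D = v.1 * w.2 - v.2 * w.1 by [].
move: eD; move: D k => D k; rewrite /det.
case: z v w u => z1 z2 [v1 v2] [w1 w2] [u1 u2] /=.
move=> eD vu kD E1 E2 S1 S2 bz bv bw nv nw nu nu'.
have [F1 T1] := flip_sign kD E1 S1; have [F2 T2] := flip_sign kD E2 S2.
have [[C1 C2]|[C1 C2]] : (`|w1| < `|v1| /\ `|v2| < `|w2|) \/ (`|v1| < `|w1| /\ `|w2| < `|v2|)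
  by clear -S1 S2 bz bv bw nv nw; lia.
  have [B1 B2 B3 B4] : [/\ 0 < `|u1|, `|u1| <= `|v1|, 0 < `|u2| & `|u2| <= `|w2| ].
    by apply: (flip_bounds _ _ _ _ C1 C2 kD F1 F2); clear -S1 S2; lia.
  (* As z - v and z + w are in the box but z + u and z - u are not, u exceeds the shorter of v and w
     in each coordinate. *)
  have [G1 G2] : `|w1| < `|u1| /\ `|v2| < `|u2|.
    by clear -S1 S2 T1 T2 bz bv bw nu nu' B1 B2 B3 B4; lia.
  have [/eqP] : v1 * u2 - v2 * u1 != 1 /\ v2 * u1 - v1 * u2 != 1; last by [].
  by apply: flip_det => //; [clear -T1; nia|clear -T2; nia|clear -S1 G1; lia].
have [B1 B2 B3 B4] : [/\ 0 < `|u2|, `|u2| <= `|v2|, 0 < `|u1| & `|u1| <= `|w1| ].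
  by apply: (flip_bounds _ _ _ _ C2 C1 kD F2 F1); clear -S1 S2; lia.
have [G1 G2] : `|w2| < `|u2| /\ `|v1| < `|u1|.
  by clear -S1 S2 T1 T2 bz bv bw nu nu' B1 B2 B3 B4; lia.
have [_ /eqP] : v2 * u1 - v1 * u2 != 1 /\ v1 * u2 - v2 * u1 != 1; last by [].
by apply: flip_det => //; [clear -T2; nia|clear -T1; nia|clear -S2 G1; lia].
Qed.

(** * Teaching sets with one zero and two ones *)

Section Teaching.

Variables (R : realType) (m n : nat).
Implicit Types (g h : binfun m n) (x z : 'I_m * 'I_n).

Definition pt x : int * int := ((x.1 : nat)%:Z, (x.2 : nat)%:Z).

Lemma pt_inj : injective pt.
Proof. by move=> [[a ha] [b hb]] [[c hc] [d hd]] [] e f; congr pair; apply: val_inj. Qed.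

Lemma inbox_pt x : inbox m n (pt x).
Proof. by rewrite /inbox /pt /=; have := ltn_ord x.1; have := ltn_ord x.2; lia. Qed.

Lemma inboxP p : inbox m n p -> exists x, pt x = p.
Proof.
case: p => a b; rewrite /inbox /= => /andP[/andP[a0 am] /andP[b0 bn]].
have ha : (`|a| < m)%N by lia.
have hb : (`|b| < n)%N by lia.
by exists (Ordinal ha, Ordinal hb); rewrite /pt /= !gez0_abs.
Qed.

Lemma threshold_det g (p c : int * int) (c0 : int) :
  (forall x, g x = false <-> det (pt x - p) c <= c0) -> threshold R g.
Proof.
move=> H; exists (c0 + (p.1 * c.2 - p.2 * c.1))%:~R, c.2%:~R, (- c.1)%:~R => x.
rewrite H !pmulrn -!intrM -intrD ler_int /det /pt /=.
by split; lia.
Qed.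

(** The zeros of the complement satisfy [0 < L x]. On a finite grid this is [d <= L x], where [d] is
    the least positive value of [L], capped at 1. *)
Lemma threshold_compl g : threshold R g -> threshold R [ffun x => ~~ g x].
Proof.
move=> [a0 [a1 [a2 H]]].
pose L (x : 'I_m * 'I_n) := a1 * (x.1 : nat)%:R + a2 * (x.2 : nat)%:R - a0.
pose d := \big[Order.min/1]_(x | 0 < L x) L x.
have d0 : 0 < d.
  by rewrite /d; elim/big_ind: _ => // a b; rewrite lt_min => -> ->.
exists (- a0 - d), (- a1), (- a2) => x; rewrite ffunE.
have -> : ~~ g x = false <-> 0 < L x.
  rewrite /L subr_gt0; case gx: (g x) => /=; split=> // h.
    by rewrite ltNge; apply/negP => /H; rewrite gx.
  by have /H := gx; rewrite leNgt h.
split=> [L0|].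
  have : d <= L x by rewrite /d; exact: bigmin_le_cond.
  by rewrite /L; lra.
by rewrite /L; lra.
Qed.

Lemma teaching_agree g h (T : {set 'I_m * 'I_n}) : teaching R g T -> threshold R h ->
  {in T, g =1 h} -> h = g.
Proof.
move=> tT th e; have [//|/eqP nh] := eqVneq h g.
by have [x xT []] := tT h th nh; exact: e.
Qed.

(** A teaching set spans: if an affine form vanishes on [T], adding any multiple of it to the form
    defining [g] changes nothing on [T], hence nothing anywhere. *)
Lemma teaching_affine g (T : {set 'I_m * 'I_n}) (p c : int * int) x :
  threshold R g -> teaching R g T ->
  {in T, forall y, det (pt y - p) c = 0} -> det (pt x - p) c = 0.
Proof.
move=> [a0 [a1 [a2 H]]] tT hT; apply/eqP; apply: contraT => nz.
pose L (y : 'I_m * 'I_n) := a1 * (y.1 : nat)%:R + a2 * (y.2 : nat)%:R - a0.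
pose l y : R := (det (pt y - p) c)%:~R.
have lx : l x != 0 by rewrite intr_eq0.
have thr (t : R) : [ffun y : 'I_m * 'I_n => 0 < L y + t * l y] = g.
  apply: (teaching_agree tT).
    exists (a0 + t * (p.1 * c.2 - p.2 * c.1)%:~R), (a1 + t * c.2%:~R), (a2 - t * c.1%:~R) => y.
    rewrite ffunE; have -> : L y + t * l y = (a1 + t * c.2%:~R) * (y.1 : nat)%:R +
       (a2 - t * c.1%:~R) * (y.2 : nat)%:R - (a0 + t * (p.1 * c.2 - p.2 * c.1)%:~R).
      by rewrite /L /l /det /pt /= !rmorphB /= !rmorphM /= !rmorphB /=; ring.
    by rewrite subr_gt0 leNgt; case: (_ < _).
  move=> y yT; rewrite ffunE /l (hT y yT) mulr0 addr0 /L subr_gt0.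
  case gy: (g y); last by apply/esym/negbTE; rewrite -leNgt; apply/H.
  by apply/esym; rewrite ltNge; apply/negP => /H; rewrite gy.
(* These multiples give the perturbed form the values 1 and 0 at [x], although both must define
   [g]. *)
have := thr ((1 - L x) / l x); rewrite -(thr (- L x / l x)).
move/ffunP/(_ x); rewrite !ffunE !divfK // subrr ltxx.
by rewrite addrC subrK ltr01.
Qed.

Section Config.
Variables (z o1 o2 : 'I_m * 'I_n).
(** With this orientation [a x] and [b x] are the coordinates of x - z in the basis o1 - z, o2 - z,
    scaled by [det v w]. *)
Let v := pt o1 - pt z.
Let w := pt z - pt o2.
Let a x := det (pt x - pt z) w.
Let b x := det (pt x - pt z) v.

Definition cone_fun : binfun m n := [ffun x => 0 < a x + b x].

(** No grid point is in the open cone at z spanned by v and w, or in the opposite cone. *)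
Definition empty_sectors := forall x, (a x <= 0 /\ b x <= 0) \/ (0 <= a x /\ 0 <= b x).

Lemma coord_z : a z = 0 /\ b z = 0.
Proof. by rewrite /a /b subrr /det !mul0r subrr. Qed.

Lemma coord_o1 : a o1 = det v w /\ b o1 = 0.
Proof. by rewrite /a /b det_refl. Qed.

Lemma coord_o2 : a o2 = 0 /\ b o2 = det v w.
Proof. by rewrite /a /b /det /v /w /pt /=; split; ring. Qed.

Section Forward.
Hypotheses (D1 : det v w = 1) (H : empty_sectors).

Lemma coord_eq x y : a x = a y -> b x = b y -> x = y.
Proof.
move=> ea eb; apply: pt_inj.
have E t : pt t - pt z = (a t * v.1 - b t * w.1, a t * v.2 - b t * w.2).
  have [] := det_cramer v (pt t - pt z) w; rewrite D1 !mul1r -/(a t) => h1 h2.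
  by rewrite [LHS]surjective_pairing h1 h2 (detC v) -/(b t) !mulNr.
by apply: (addIr (- pt z)); rewrite !E ea eb.
Qed.

Lemma cone_fun_threshold : threshold R cone_fun.
Proof.
apply: (threshold_det (p := pt z) (c := v + w) (c0 := 0)) => x; rewrite ffunE.
have -> : det (pt x - pt z) (v + w) = a x + b x.
  by rewrite /a /b /det /=; ring.
by rewrite leNgt; case: (_ < _).
Qed.

Lemma cone_fun_values : [/\ cone_fun z = false, cone_fun o1 = true & cone_fun o2 = true].
Proof.
by have [] := coord_z; have [] := coord_o1; have [] := coord_o2;
   rewrite !ffunE => -> -> -> -> -> ->; rewrite D1.
Qed.

(** An affine form L satisfies L x = (1 - a - b) L z + a L o1 + b L o2. The integers a and b have a
    common sign, so the signs of L at the three points force its sign at every grid point. *)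
Lemma cone_fun_teaching : teaching R cone_fun [set z; o1; o2].
Proof.
move=> h [a0 [a1 [a2 hh]]] nh; apply: contra_notP nh => N.
have agree x : x \in [set z; o1; o2] -> cone_fun x = h x.
  by move=> xT; apply: contrapT => e; apply: N; exists x.
pose L (y : 'I_m * 'I_n) := a1 * (y.1 : nat)%:R + a2 * (y.2 : nat)%:R - a0.
have hL x : h x = (0 < L x).
  rewrite /L subr_gt0; case hx: (h x); last by apply/esym/negbTE; rewrite -leNgt; apply/hh.
  by apply/esym; rewrite ltNge; apply/negP => /hh; rewrite hx.
have [vz v1 v2] := cone_fun_values.
have Lz : L z <= 0 by rewrite leNgt -hL -agree ?vz // !inE eqxx.
have L1 : 0 < L o1 by rewrite -hL -agree ?v1 // !inE eqxx orbT.
have L2 : 0 < L o2 by rewrite -hL -agree ?v2 // !inE eqxx orbT.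
apply/ffunP => x; rewrite hL ffunE.
have E : L x = (1 - (a x)%:~R - (b x)%:~R) * L z + (a x)%:~R * L o1 + (b x)%:~R * L o2.
  have [h1 h2] := det_cramer v (pt x - pt z) w.
  move: h1 h2; rewrite D1 !mul1r -/(a x) (detC v) -/(b x).
  move: (a x) (b x) => s t.
  move=> /(congr1 (fun t : int => t%:~R : R)) h1 /(congr1 (fun t : int => t%:~R : R)) h2.
  move: h1 h2; rewrite /v /w /pt /= !rmorphD /= !rmorphM /= !rmorphN /= !rmorphB /= => h1 h2.
  have -> : L x = L z + a1 * ((x.1 : nat)%:Z%:~R - (z.1 : nat)%:Z%:~R)
                      + a2 * ((x.2 : nat)%:Z%:~R - (z.2 : nat)%:Z%:~R).
    by rewrite /L -!pmulrn; ring.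
  by rewrite h1 h2 /L -!pmulrn; ring.
have [[ha hb]|[ha hb]] := H x.
  have ha' : (a x)%:~R <= 0 :> R by rewrite lerz0.
  have hb' : (b x)%:~R <= 0 :> R by rewrite lerz0.
  have -> : (0 < a x + b x) = false by lia.
  by apply/negbTE; rewrite -leNgt E; nra.
have ha' : 0 <= (a x)%:~R :> R by rewrite ler0z.
have hb' : 0 <= (b x)%:~R :> R by rewrite ler0z.
have [s0|s0] := ltP 0 (a x + b x).
  have s1 : 1 <= (a x)%:~R + (b x)%:~R :> R by rewrite -intrD ler1z.
  have p0 : 0 <= ((a x)%:~R + (b x)%:~R - 1) * - L z.
    by rewrite mulr_ge0 ?subr_ge0 ?oppr_ge0.
  apply/esym; rewrite E.
  have [h1|h1] : 1 <= a x \/ 1 <= b x by move: s0; clear; move: (a x) (b x) => i j; lia.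
    have h2 : 1 <= (a x)%:~R :> R by rewrite ler1z.
    have h3 := mulr_ge0 hb' (ltW L2).
    have h4 : L o1 <= (a x)%:~R * L o1 by rewrite ler_peMl // ltW.
    by lra.
  have h2 : 1 <= (b x)%:~R :> R by rewrite ler1z.
  have h3 := mulr_ge0 ha' (ltW L1).
  have h4 : L o2 <= (b x)%:~R * L o2 by rewrite ler_peMl // ltW.
  by lra.
have -> : x = z.
  have [az bz] := coord_z.
  by apply: coord_eq; rewrite ?az ?bz; move: ha hb s0; clear; move: (a x) (b x) => i j; lia.
by apply/negbTE; rewrite -leNgt.
Qed.

(** Changing the value at [p] alone leaves a threshold function: shift the line just past z, or tilt
    it so that it passes through o1 or o2 while the other ones stay beyond it. So [T] must contain
    [p]. *)
Lemma cone_fun_essential p (T : {set 'I_m * 'I_n}) :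
  p \in [set z; o1; o2] -> teaching R cone_fun T -> p \in T.
Proof.
move=> pT tT; pose h : binfun m n := [ffun x => if x == p then ~~ cone_fun x else cone_fun x].
have nh : h <> cone_fun.
  by move=> /ffunP/(_ p); rewrite ffunE eqxx; case: (cone_fun p).
suff th : threshold R h.
  have [x xT] := tT h th nh; rewrite [h x]ffunE; case: eqP => [<- //|_] //.
have [az bz] := coord_z; have [ao1 bo1] := coord_o1; have [ao2 bo2] := coord_o2.
rewrite D1 in ao1 bo2.
move: pT; rewrite !inE -orbA => /or3P[] /eqP ep; subst p; clear nh.
- apply: (threshold_det (p := pt z) (c := v + w) (c0 := - 1)) => x; rewrite !ffunE.
  have -> : det (pt x - pt z) (v + w) = a x + b x by rewrite /a /b /det /=; ring.
  case: eqP => [->|/eqP nx]; first by rewrite az bz.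
  have : ~ (a x = 0 /\ b x = 0).
    by move=> [ex fx]; case/eqP: nx; apply: coord_eq; rewrite ?az ?bz.
  have := H x; move: (a x) (b x) => s t Hx nst.
  by split; lia.
- apply: (threshold_det (p := pt z) (c := v + v + w) (c0 := 1)) => x; rewrite !ffunE.
  have -> : det (pt x - pt z) (v + v + w) = a x + b x + b x by rewrite /a /b /det /=; ring.
  case: eqP => [->|/eqP nx]; first by rewrite ao1 bo1.
  have : ~ (a x = 1 /\ b x = 0).
    by move=> [ex fx]; case/eqP: nx; apply: coord_eq; rewrite ?ao1 ?bo1.
  have := H x; move: (a x) (b x) => s t Hx nst.
  by split; lia.
- apply: (threshold_det (p := pt z) (c := v + w + w) (c0 := 1)) => x; rewrite !ffunE.
  have -> : det (pt x - pt z) (v + w + w) = a x + a x + b x by rewrite /a /b /det /=; ring.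
  case: eqP => [->|/eqP nx]; first by rewrite ao2 bo2.
  have : ~ (a x = 0 /\ b x = 1).
    by move=> [ex fx]; case/eqP: nx; apply: coord_eq; rewrite ?ao2 ?bo2.
  have := H x; move: (a x) (b x) => s t Hx nst.
  by split; lia.
Qed.

Lemma teaching_set_cone_fun : teaching_set R cone_fun = [set z; o1; o2].
Proof.
have [tT minT] := teaching_setP R cone_fun.
apply/esym/eqP; rewrite finset.eqEsubset; apply/andP; split.
  by apply/fintype.subsetP => p pT; exact: cone_fun_essential tT.
have sub : [set z; o1; o2] \subset teaching_set R cone_fun.
  by apply/fintype.subsetP => p pT; exact: cone_fun_essential tT.
apply: contraT => ns; exfalso; apply: (minT [set z; o1; o2]); last exact: cone_fun_teaching.
by rewrite properE sub.
Qed.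

End Forward.

Section Backward.
Variables (g : binfun m n).
Hypotheses (tT : teaching R g [set z; o1; o2])
  (gz : g z = false) (g1 : g o1 = true) (g2 : g o2 = true) (D0 : 0 < det v w).

(** The form with weights A + B1 and A + B2 exceeds the level A [det v w] at o1 and o2 but not at z,
    so it defines [g]. Varying the parameters constrains the grid. *)
Lemma forced (A B1 B2 : int) x : 0 <= A -> 0 < B1 -> 0 < B2 ->
  g x = (A * det v w < (A + B1) * a x + (A + B2) * b x).
Proof.
move=> A0 B10 B20.
pose c : int * int := ((A + B1) * w.1 + (A + B2) * v.1, (A + B1) * w.2 + (A + B2) * v.2).
have E y : det (pt y - pt z) c = (A + B1) * a y + (A + B2) * b y.
  by rewrite /a /b /det /c /=; ring.
pose h : binfun m n := [ffun y => A * det v w < det (pt y - pt z) c].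
have <- : h = g; last by rewrite ffunE E.
apply: (teaching_agree tT).
  apply: (threshold_det (p := pt z) (c := c) (c0 := A * det v w)) => y.
  by rewrite ffunE leNgt; case: (_ < _).
move=> y; rewrite !inE -orbA ffunE E => /or3P[] /eqP ->.
- have [-> ->] := coord_z; rewrite gz !mulr0 addr0; apply/esym/negbTE.
  by rewrite -leNgt mulr_ge0 // ltW.
- have [-> ->] := coord_o1; rewrite g1 mulr0 addr0; apply/esym.
  by rewrite mulrDl ltrDl mulr_gt0.
- have [-> ->] := coord_o2; rewrite g2 mulr0 add0r; apply/esym.
  by rewrite mulrDl ltrDl mulr_gt0.
Qed.

Lemma forced_sectors : empty_sectors.
Proof.
move=> x; apply: contrapT => N.
have [[a0 b0]|[a0 b0]] : 0 < a x /\ b x < 0 \/ a x < 0 /\ 0 < b x by lia.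
  (* Two admissible weightings, each tilted to favour one coordinate, disagree at [x]. *)
  have := @forced 0 (1 - b x) 1 x; rewrite (@forced 0 1 (1 + a x) x) //; last by lia.
  have -> : (0 * det v w < (0 + 1) * a x + (0 + (1 + a x)) * b x) = false.
    by apply/negbTE; rewrite -leNgt; nia.
  have -> : (0 * det v w < (0 + (1 - b x)) * a x + (0 + 1) * b x) = true by nia.
  by move=> F; have : false = true by apply: F; lia.
have := @forced 0 1 (1 - a x) x; rewrite (@forced 0 (1 + b x) 1 x) //; last by lia.
have -> : (0 * det v w < (0 + (1 + b x)) * a x + (0 + 1) * b x) = false.
  by apply/negbTE; rewrite -leNgt; nia.
have -> : (0 * det v w < (0 + 1) * a x + (0 + (1 - a x)) * b x) = true by nia.
by move=> F; have : false = true by apply: F; lia.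
Qed.

(** No grid point but z lies in the triangle below the line o1 o2: at such a point the level 0 gives
    a one, and the level A = [a x + b x] a zero. *)
Lemma forced_triangle x : 0 <= a x -> 0 <= b x -> 0 < a x + b x -> det v w <= a x + b x.
Proof.
move=> a0 b0 s0; rewrite leNgt; apply/negP => sD.
have := @forced (a x + b x) 1 1 x; rewrite (@forced 0 1 1 x) //.
have -> : ((a x + b x) * det v w < (a x + b x + 1) * a x + (a x + b x + 1) * b x) = false.
  by apply/negbTE; rewrite -leNgt -mulrDr mulrC; nia.
have -> : (0 * det v w < (0 + 1) * a x + (0 + 1) * b x) = true by lia.
by move=> F; have : true = false by apply: F; lia.
Qed.

Lemma forced_eq : g = cone_fun.
Proof. by apply/ffunP => x; rewrite (@forced 0 1 1 x) // ffunE mul0r add0r !mul1r. Qed.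

(** A non-primitive side would carry, by convexity of the box, a grid point contradicting
    [forced_triangle]. *)
Lemma forced_prim : prim v /\ prim w.
Proof.
split.
  have nz : v != 0 by apply/eqP => e; move: D0; rewrite e /det !mul0r subrr.
  have [g0 [y [g00 py ey]]] := primitive_part nz.
  have [x ex] : exists x, pt x = pt z + y.
    apply: inboxP; have := inbox_pt z; have := inbox_pt o1.
    have -> : pt o1 = pt z + v by rewrite addrC subrK.
    by rewrite ey /inbox /= => *; nia.
  have bx : b x = 0 by rewrite /b ex addrC addKr ey /det /=; ring.
  have ax : g0 * a x = det v w by rewrite /a ex addrC addKr ey /det /=; ring.
  have ax0 : 0 < a x by nia.
  have := @forced_triangle x; rewrite bx addr0 -ax => /(_ (ltW ax0) (lexx _) ax0) h.
  have -> : v = y; last by [].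
  have g1' : g0 = 1 by nia.
  by rewrite ey g1' !mul1r -surjective_pairing.
have nz : w != 0 by apply/eqP => e; move: D0; rewrite e /det !mulr0 subrr.
have [g0 [y [g00 py ey]]] := primitive_part nz.
have [x ex] : exists x, pt x = pt z - y.
  apply: inboxP; have := inbox_pt z; have := inbox_pt o2.
  have -> : pt o2 = pt z - w by rewrite opprB addrC subrK.
  by rewrite ey /inbox /= => *; nia.
have ax : a x = 0 by rewrite /a ex addrC addKr ey /det /=; ring.
have bx : g0 * b x = det v w by rewrite /b ex addrC addKr ey /det /=; ring.
have bx0 : 0 < b x by nia.
have := @forced_triangle x; rewrite ax add0r -bx => /(_ (lexx _) (ltW bx0) bx0) h.
have -> : w = y; last by [].
have g1' : g0 = 1 by nia.
by rewrite ey g1' !mul1r -surjective_pairing.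
Qed.

End Backward.
End Config.
End Teaching.

(** * Counting configurations *)

Section Configurations.

Variables (R : realType) (m n : nat).

Local Notation G := ('I_m * 'I_n)%type.
Local Notation W := ('I_m.*2.+1 * 'I_n.*2.+1)%type.
Implicit Types (x z : G) (t : W).

(* Vectors with coordinates bounded by m and n are encoded by adding (m, n);
   outside this range [ofvec] returns junk. *)
Definition vec t : int * int := ((t.1 : nat)%:Z - m%:Z, (t.2 : nat)%:Z - n%:Z).

Definition neg_dir t : W := (rev_ord t.1, rev_ord t.2).

Definition ofvec (p : int * int) : W := (inord `|p.1 + m%:Z|, inord `|p.2 + n%:Z|).

Lemma ofvecK p : `|p.1| <= m%:Z -> `|p.2| <= n%:Z -> vec (ofvec p) = p.
Proof.
case: p => a b /= ha hb; rewrite /vec /ofvec /= !inordK; first by congr pair; lia.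
  by lia.
by lia.
Qed.

Lemma vec_inj : injective vec.
Proof. by move=> [[a ha] [b hb]] [[c hc] [d hd]] [] e f; congr pair; apply: val_inj => /=; lia. Qed.

Lemma vec_opp t : vec (neg_dir t) = - vec t.
Proof.
case: t => -[a ha] [b hb]; rewrite /vec /neg_dir /= -[RHS]/(_, _) /=; congr pair; lia.
Qed.

(** [vis z] and [dirs z] are the sets P and Q of the angular part, taken at [z]. *)
Definition vis z : {set W} := [set t | prim (vec t) && inbox m n (pt z + vec t)].

Definition dirs z : {set W} := [set t | (t \in vis z) || (neg_dir t \in vis z)].

Lemma dirsE z t : (t \in dirs z) = (t \in vis z) || (neg_dir t \in vis z).
Proof. by rewrite inE. Qed.

Lemma visE z t : (t \in vis z) = prim (vec t) && inbox m n (pt z + vec t).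
Proof. by rewrite inE. Qed.

Lemma visN z t : (neg_dir t \in vis z) = prim (vec t) && inbox m n (pt z - vec t).
Proof. by rewrite inE vec_opp primN. Qed.

Lemma vis_ofvec z p : inbox m n (pt z + p) -> prim p ->
  vec (ofvec p) = p /\ ofvec p \in vis z.
Proof.
move=> bp pp; have E : vec (ofvec p) = p.
  case: p bp {pp} => a b bp; move: bp (inbox_pt z); rewrite /inbox /= => h1 h2.
  by apply: ofvecK => /=; lia.
by rewrite visE E pp.
Qed.

Lemma visN_ofvec z p : inbox m n (pt z - p) -> prim p ->
  vec (ofvec p) = p /\ neg_dir (ofvec p) \in vis z.
Proof.
move=> bp pp; have E : vec (ofvec p) = p.
  case: p bp {pp} => a b bp; move: bp (inbox_pt z); rewrite /inbox /= => h1 h2.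
  by apply: ofvecK => /=; lia.
by rewrite visN E pp.
Qed.

Hypotheses (m2 : (2 <= m)%N) (n2 : (2 <= n)%N).

(** Relies on m, n >= 2, and makes [dirs z] span the plane. *)
Lemma axis_nbrs z : (inbox m n (pt z + (1, 0)) || inbox m n (pt z + (- 1, 0))) &&
  (inbox m n (pt z + (0, 1)) || inbox m n (pt z + (0, - 1))).
Proof. by have := inbox_pt z; rewrite /inbox /=; lia. Qed.

Lemma dirs_opp z t : t \in dirs z -> neg_dir t \in dirs z.
Proof. by rewrite !dirsE (dir_oppK vec_inj vec_opp) orbC. Qed.

Lemma dirs_prim z t : t \in dirs z -> prim (vec t).
Proof. by rewrite dirsE visE visN => /orP[] /andP[]. Qed.

Lemma dirs_span z t : t \in dirs z -> exists2 w, w \in dirs z & det (vec t) (vec w) != 0.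
Proof.
move=> td; have := dirs_prim td; case: (vec t) => a b pab.
have /andP[h1 h2] := axis_nbrs z.
have [b0|b0] := eqVneq b 0.
  have a0 : a != 0 by apply: contraTneq pab => ->; rewrite b0.
  case/orP: h2 => h2; have [//|E wv] := vis_ofvec h2.
    by exists (ofvec (0, 1)); rewrite ?dirsE ?wv // E /det /=; lia.
  by exists (ofvec (0, - 1)); rewrite ?dirsE ?wv // E /det /=; lia.
case/orP: h1 => h1; have [//|E wv] := vis_ofvec h1.
  by exists (ofvec (1, 0)); rewrite ?dirsE ?wv // E /det /=; lia.
by exists (ofvec (- 1, 0)); rewrite ?dirsE ?wv // E /det /=; lia.
Qed.

Local Notation nextz z := (succ_dir vec (dirs z)).

Lemma nextzP z t : t \in dirs z -> isnext vec (dirs z) t (nextz z t).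
Proof.
by move=> td; apply: (nextP vec_opp _ _ td); [exact: dirs_opp | exact: dirs_span].
Qed.

(** Extends emptiness of the cone from primitive vectors to all vectors: the primitive part of [x]
    stays in the cone and, by convexity, its endpoint stays in the box. *)
Lemma nextz_empty z t (x : int * int) : t \in dirs z ->
  0 < det (vec t) x -> 0 < det x (vec (nextz z t)) ->
  ~~ inbox m n (pt z + x) && ~~ inbox m n (pt z - x).
Proof.
move=> td tx xw; have /isnextP[wd tw H] := nextzP td.
have nz : x != 0 by apply/eqP => e; move: tx; rewrite e /det !mulr0 subrr.
have [g [y [g0 py ey]]] := primitive_part nz.
have ty : 0 < det (vec t) y.
  by rewrite -(pmulr_rgt0 _ g0); move: tx; rewrite ey /det /=; lia.
have yw : 0 < det y (vec (nextz z t)).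
  by rewrite -(pmulr_rgt0 _ g0); move: xw; rewrite ey /det /=; lia.
rewrite -negb_or; apply/negP => /orP[] bx.
  have by_ : inbox m n (pt z + y).
    by move: bx (inbox_pt z); rewrite ey /inbox /=; nia.
  have [E yv] := vis_ofvec by_ py.
  by apply: (H (ofvec y)); rewrite ?dirsE ?yv // E.
have by_ : inbox m n (pt z - y).
  by move: bx (inbox_pt z); rewrite ey /inbox /=; nia.
have [E yv] := visN_ofvec by_ py.
by apply: (H (ofvec y)); rewrite ?dirsE ?yv ?orbT // E.
Qed.

Definition confs z : {set W} := conf vec neg_dir (dirs z) (vis z) (dirs z).

Lemma confsP z t : reflect (t \in vis z /\ neg_dir (nextz z t) \in vis z) (t \in confs z).
Proof.
rewrite mem_conf dirsE; apply: (iffP idP) => [/and3P[] //|[-> ->] //].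
Qed.

Definition conf_fun (c : G * W) : binfun m n :=
  [ffun x => 0 < det (pt x - pt c.1) (vec (nextz c.1 c.2)) + det (pt x - pt c.1) (vec c.2)].

(** Translates a configuration into a triple: o1 = z + t and o2 = z - succ t, with unimodularity
    from [unimodular_next]. *)
Lemma confs_spec z t : t \in confs z -> exists o1 o2,
  [/\ pt o1 - pt z = vec t, pt z - pt o2 = vec (nextz z t),
      det (pt o1 - pt z) (pt z - pt o2) = 1, empty_sectors z o1 o2 &
      conf_fun (z, t) = cone_fun z o1 o2].
Proof.
case/confsP => tv nv; have td : t \in dirs z by rewrite dirsE tv.
have /isnextP[wd tw _] := nextzP td.
have pv := dirs_prim td; have pw := dirs_prim wd.
move: tv nv; rewrite visE visN pv pw /= => bv bw.
have [ o1 e1] := inboxP bv; have [ o2 e2] := inboxP bw.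
have E1 : pt o1 - pt z = vec t by rewrite e1 addrC addKr.
have E2 : pt z - pt o2 = vec (nextz z t) by rewrite e2 opprB addrC subrK.
exists o1, o2; split => //.
- rewrite E1 E2; apply: (unimodular_next pv pw tw (inbox_pt z) bv bw) => x; exact: nextz_empty.
- move=> x; rewrite E1 E2.
  have h1 := @nextz_empty z t (pt x - pt z) td; have h2 := @nextz_empty z t (- (pt x - pt z)) td.
  move: h1 h2; rewrite opprK detNr detNl (addrC (pt z) (pt x - pt z)) subrK inbox_pt /= andbF (detC (vec t)).
  by move: (det _ _) (det _ _) => a b; lia.
by apply/ffunP => x; rewrite !ffunE E1 E2.
Qed.

(** The function determines its teaching set, z is the only zero there, and the orientation
    [det = 1] tells o1 from o2. *)
Lemma conf_fun_inj z t z' t' : t \in confs z -> t' \in confs z' ->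
  conf_fun (z, t) = conf_fun (z', t') -> (z, t) = (z', t').
Proof.
move=> /confs_spec[ o1 [ o2 [e1 e2 D1 H E]]] /confs_spec[p1 [p2 [f1 f2 D1' H' E']]] eF.
have := teaching_set_cone_fun R D1' H'; rewrite -E' -eF E (teaching_set_cone_fun R D1 H) => eT.
have [vz v1 v2] := cone_fun_values D1; have [vz' v1' v2'] := cone_fun_values D1'.
rewrite -E' -eF E in vz' v1' v2'.
have mz : z' \in [set z; o1; o2] by rewrite eT !inE eqxx.
have m1 : p1 \in [set z; o1; o2] by rewrite eT !inE eqxx orbT.
have m2' : p2 \in [set z; o1; o2] by rewrite eT !inE eqxx orbT.
have ez : z' = z.
  move: mz; rewrite !inE -orbA => /or3P[] /eqP e //; move: vz'; rewrite e.
    by rewrite v1.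
  by rewrite v2.
subst z'; congr pair; apply: vec_inj; rewrite -e1 -f1; congr (_ - _).
move: m1; rewrite !inE -orbA => /or3P[] /eqP e; subst p1 => //.
  by rewrite vz in v1'.
exfalso; move: m2'; rewrite !inE -orbA => /or3P[] /eqP e; subst p2.
- by rewrite vz in v2'.
- by move: D1 D1'; rewrite /det /=; lia.
- by move: D1'; rewrite /det /=; lia.
Qed.

End Configurations.

(** * Threshold functions and configurations *)

Section Bijection.

Variables (R : realType) (m n : nat).
Hypotheses (m2 : (2 <= m)%N) (n2 : (2 <= n)%N).

Local Notation G := ('I_m * 'I_n)%type.
Local Notation W := ('I_m.*2.+1 * 'I_n.*2.+1)%type.
Local Notation nextz z := (succ_dir (@vec m n) (dirs z)).
Implicit Types (x z : G) (t : W).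

Definition conf_set : {set G * W} := [set c | c.2 \in confs c.1].

Lemma mem_conf_set c : (c \in conf_set) = (c.2 \in confs c.1).
Proof. by rewrite inE. Qed.

Lemma nonzero_det_nbr z (c : int * int) : c != 0 -> exists x : G, det (pt x - pt z) c != 0.
Proof.
move=> nz; have /andP[h1 h2] := axis_nbrs m2 n2 z.
have [c2|c2] := eqVneq c.2 0.
  have c1 : c.1 != 0 by apply: contraNneq nz => c1; rewrite [c]surjective_pairing c1 c2.
  case/orP: h2 => /inboxP[x ex]; exists x.
    by rewrite ex addrC addKr /det /= mul0r mul1r sub0r oppr_eq0.
  by rewrite ex addrC addKr /det /= mul0r mulN1r sub0r opprK.
case/orP: h1 => /inboxP[x ex]; exists x.
  by rewrite ex addrC addKr /det /= mul0r mul1r subr0.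
by rewrite ex addrC addKr /det /= mul0r mulN1r subr0 oppr_eq0.
Qed.

(** The [forced] lemmas give primitive sides and empty sectors, which is what identifies z - o2 as
    the successor of o1 - z. *)
Lemma oriented_conf (g : binfun m n) z o1 o2 :
  teaching R g [set z; o1; o2] -> g z = false -> g o1 = true -> g o2 = true ->
  0 < det (pt o1 - pt z) (pt z - pt o2) ->
  exists t, t \in confs z /\ g = conf_fun (z, t).
Proof.
move=> tT gz g1 g2 D0.
have [pv pw] := forced_prim tT gz g1 g2 D0.
have H := forced_sectors tT gz g1 g2 D0.
have bv : inbox m n (pt z + (pt o1 - pt z)) by rewrite addrC subrK inbox_pt.
have bw : inbox m n (pt z - (pt z - pt o2)) by rewrite opprB addrC subrK inbox_pt.
have [E1 v1] := vis_ofvec bv pv; have [E2 v2] := visN_ofvec bw pw.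
set t := ofvec _ _ _ in E1 v1; set s := ofvec _ _ _ in E2 v2.
have td : t \in dirs z by rewrite dirsE v1.
have sd : s \in dirs z by rewrite dirsE v2 orbT.
have Hx x : 0 < det (vec t) (pt x - pt z) -> 0 < det (pt x - pt z) (vec s) -> False.
  by rewrite E1 E2 detC => h1 h2; move: (H x) h1 h2; clear; move: (det _ _) (det _ _) => a b; lia.
have Hx' x : det (vec t) (pt x - pt z) < 0 -> det (pt x - pt z) (vec s) < 0 -> False.
  by rewrite E1 E2 detC => h1 h2; move: (H x) h1 h2; clear; move: (det _ _) (det _ _) => a b; lia.
have ts : nextz z t = s.
  apply: (isnext_uniq (@vec_inj m n) (@vec_opp m n) (@dirs_prim m n z) (nextzP m2 n2 td)).
  apply/isnextP; split => //; first by rewrite E1 E2.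
  move=> x; rewrite dirsE visE visN => /orP[] /andP[_] /inboxP[y ey] h1 h2.
    by apply: (Hx y); rewrite ey addrC addKr.
  by apply: (Hx' y); rewrite ey addrC addKr ?detNr ?detNl oppr_lt0.
exists t; split; first by apply/confsP; rewrite ts.
apply/ffunP => x; rewrite (forced_eq tT gz g1 g2 D0) !ffunE /= ts E1 E2 //.
Qed.

Lemma conf_of_teaching (g : binfun m n) : threshold R g -> #|teaching_set R g| = 3%N ->
  #|[set x in teaching_set R g | g x == false]| = 1%N ->
  exists2 c, c \in conf_set & g = conf_fun c.
Proof.
move=> tg T3 Z1; have [tT _] := teaching_setP R g; move: tT T3 Z1.
set T := teaching_set R g => tT T3 /eqP/cards1P[z eZ].
have : #|[set x in T | g x == true]| == 2%N.
  apply/eqP; move: (cardsID [set x | g x == false] T); rewrite T3.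
  have -> : T :&: [set x | g x == false] = [set x in T | g x == false].
    by apply/finset.setP => x; rewrite !inE.
  rewrite eZ cards1.
  have -> : T :\: [set x | g x == false] = [set x in T | g x == true].
    by apply/finset.setP => x; rewrite !inE; case: (g x); rewrite ?andbT ?andbF.
  by rewrite add1n => -[].  
case/cards2P => o1 [ o2 [no eO] ].
have mz : z \in T /\ g z = false.
  have : z \in [set x in T | g x == false] by rewrite eZ inE.
  by rewrite !inE => /andP[-> /eqP].
have mo1 : o1 \in T /\ g o1 = true.
  have : o1 \in [set x in T | g x == true] by rewrite eO !inE eqxx.
  by rewrite !inE => /andP[-> /eqP].
have mo2 : o2 \in T /\ g o2 = true.
  have : o2 \in [set x in T | g x == true] by rewrite eO !inE eqxx orbT.
  by rewrite !inE => /andP[-> /eqP].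
have eT : T = [set z; o1; o2].
  apply/finset.setP => x; have : (x \in T) =
      (x \in [set x in T | g x == false]) || (x \in [set x in T | g x == true]).
    by rewrite !inE; case: (x \in T); case: (g x).
  by rewrite eZ eO !inE orbA.
have [_ gz] := mz; have [_ g1] := mo1; have [_ g2] := mo2.
clear mz mo1 mo2 eZ eO T3; rewrite eT in tT.
have nz : pt o1 - pt z != 0.
  by rewrite subr_eq0; apply/eqP => /pt_inj e; move: g1; rewrite e gz.
have D0 : det (pt o1 - pt z) (pt z - pt o2) != 0.
  (* If the triple were collinear, the line through it would contain the whole grid, by
     [teaching_affine]. *)
  apply/eqP => D0; have [x] := nonzero_det_nbr z nz; case/eqP.
  apply: (@teaching_affine R m n g [set z; o1; o2] (pt z) (pt o1 - pt z) x tg tT) => y.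
  rewrite !inE -orbA => /or3P[] /eqP ->.
  - by rewrite subrr /det !mul0r subrr.
  - exact: det_refl.
  - by move: D0; rewrite -[pt z - pt o2]opprB detNr -detC.
case: (ltgtP 0 (det (pt o1 - pt z) (pt z - pt o2))) D0 => // D0 _.
  have [t [tc e]] := oriented_conf tT gz g1 g2 D0.
  by exists (z, t); rewrite ?mem_conf_set.
(* Exchanging o1 and o2 makes the orientation positive. *)
have tT' : teaching R g [set z; o2; o1].
  by rewrite -finset.setUA [ [set o2] :|: _]finset.setUC finset.setUA.
have [t [tc e]] : exists t, t \in confs z /\ g = conf_fun (z, t).
  apply: (oriented_conf tT' gz g2 g1).
  by move: D0; rewrite /det /=; lia.
by exists (z, t); rewrite ?mem_conf_set.
Qed.

Lemma conf_fun_pred z t : t \in confs z ->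
  [/\ threshold R (conf_fun (z, t)), #|teaching_set R (conf_fun (z, t))| = 3%N,
    #|[set x in teaching_set R (conf_fun (z, t)) | conf_fun (z, t) x == false]| = 1%N &
    #|[set x in teaching_set R (conf_fun (z, t)) | conf_fun (z, t) x == true]| = 2%N].
Proof.
move=> /(confs_spec m2 n2)[ o1 [ o2 [e1 e2 D1 H E]]].
have [vz v1 v2] := cone_fun_values D1.
have eT := teaching_set_cone_fun R D1 H; rewrite E eT.
have nz1 : z != o1 by apply/eqP => /(congr1 (cone_fun z o1 o2)); rewrite vz v1.
have nz2 : z != o2 by apply/eqP => /(congr1 (cone_fun z o1 o2)); rewrite vz v2.
have no : o1 != o2 by apply/eqP => e; move: D1; rewrite e /det /=; lia.
split; first exact: cone_fun_threshold.
- by rewrite -finset.setUA cardsU1 cards2 !inE negb_or nz1 nz2 no.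
- rewrite (_ : [set x in _ | _] = [set z]) ?cards1 //.
  apply/finset.setP => x; rewrite !inE.
  have [->|nx] := eqVneq x z; first by rewrite vz.
  have [->|nx1] := eqVneq x o1; first by rewrite v1.
  by have [->|nx2] := eqVneq x o2; first by rewrite v2.
- rewrite (_ : [set x in _ | _] = [set o1; o2]) ?cards2 ?no //.
  apply/finset.setP => x; rewrite !inE.
  have [->|nx] := eqVneq x z; first by rewrite vz (negbTE nz1) (negbTE nz2).
  have [->|nx1] := eqVneq x o1; first by rewrite v1.
  by have [->|nx2] := eqVneq x o2; first by rewrite v2.
Qed.

Definition origin : G := (Ordinal (ltnW m2), Ordinal (ltnW n2)).

Lemma u_one nu : u R m n nu 1 = #|[set c in conf_set | conf_fun c origin == nu]|.
Proof.
rewrite /u -(card_in_imset (f := @conf_fun m n)).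
  apply: eq_card => g; rewrite inE; apply/asboolP/imsetP.
    move=> [tg T3 org Z1 _].
    have [c cC e] := conf_of_teaching tg T3 Z1.
    by exists c => //; apply/finset.setIdP; rewrite -e org.
  move=> [[z t]] /finset.setIdP[]; rewrite mem_conf_set => tc /eqP o ->.
  have [h1 h2 h3 h4] := conf_fun_pred tc; split => //.
  by move=> x x1 x2; rewrite (_ : x = origin) //; apply: pt_inj; rewrite /pt x1 x2.
move=> [z t] [z' t'] /finset.setIdP[]; rewrite mem_conf_set => tc _.
move=> /finset.setIdP[]; rewrite mem_conf_set => tc' _.
exact: (conf_fun_inj R m2 n2).
Qed.

Lemma teaching_compl (g : binfun m n) T :
  teaching R g T -> teaching R [ffun x => ~~ g x] T.
Proof.
move=> tT h th nh.
have nh' : [ffun x => ~~ h x] <> g.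
  by move=> e; apply: nh; apply/ffunP => x; rewrite -e !ffunE negbK.
have [x xT ne] := tT _ (threshold_compl th) nh'; exists x => //.
by move: ne; rewrite !ffunE; case: (g x); case: (h x).
Qed.

Lemma ffun_negbK (g : binfun m n) : [ffun x => ~~ [ffun y => ~~ g y] x] = g.
Proof. by apply/ffunP => x; rewrite !ffunE negbK. Qed.

Lemma teaching_set_compl (g : binfun m n) :
  teaching_set R [ffun x => ~~ g x] = teaching_set R g.
Proof.
have E T : teaching R [ffun x => ~~ g x] T <-> teaching R g T.
  split; last exact: teaching_compl.
  by move/teaching_compl; rewrite ffun_negbK.
rewrite /teaching_set; congr odflt; apply: eq_pick => T; apply/asboolP/asboolP => -[tT mT].
  by split; [apply/E | move=> T' /mT nT /E].
by split; [apply/E | move=> T' /mT nT /E].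
Qed.

(** Complementation is an involution on threshold functions that keeps the teaching set and
    exchanges zeros and ones. *)
Lemma u_compl nu kappa : (kappa <= 3)%N -> u R m n (~~ nu) (3 - kappa) = u R m n nu kappa.
Proof.
move=> k3; pose F (g : binfun m n) : binfun m n := [ffun x => ~~ g x].
have FK : involutive F by move=> g; exact: ffun_negbK.
have main nu' k g : (k <= 3)%N -> u_pred R nu' k g -> u_pred R (~~ nu') (3 - k) (F g).
  move=> k3' [tg T3 o h1 h2]; split.
  - exact: threshold_compl.
  - by rewrite teaching_set_compl.
  - by move=> x x1 x2; rewrite ffunE o.
  - rewrite teaching_set_compl -h2; apply: eq_card => x; rewrite !inE ffunE.
    by case: (g x).
  - rewrite teaching_set_compl subKn // -h1; apply: eq_card => x; rewrite !inE ffunE.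
    by case: (g x).
rewrite /u -(card_imset _ (can_inj FK)); apply: eq_card => g; rewrite inE.
apply/imsetP/asboolP => [[h]|ug].
  rewrite inE => /asboolP /main; rewrite leq_subr negbK subKn // => uh ->.
  exact: uh.
by exists (F g); rewrite ?FK // inE; apply/asboolP; exact: main.
Qed.

End Bijection.

(* [s1] and [s2] are the signs of the directions pointing into the grid. *)
Lemma corner_flip_dir (s1 s2 : int) (d w : int * int) :
  s1 = 1 \/ s1 = - 1 -> s2 = 1 \/ s2 = - 1 -> prim d ->
  s1 * d.1 <= 0 -> s2 * d.2 <= 0 -> 0 <= s1 * w.1 -> 0 <= s2 * w.2 -> 0 < det d w ->
  (forall x, x = (s1, 0) \/ x = (- s1, 0) \/ x = (0, s2) \/ x = (0, - s2) ->
     0 < det d x -> 0 < det x w -> False) ->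
  d = if s1 == s2 then (0, - s2) else (- s1, 0).
Proof.
have prim1 (a : int) : coprimez a 0 -> a = 1 \/ a = - 1.
  by rewrite /coprimez gcdz0 => /eqP; lia.
case: d w => d1 d2 [w1 w2] S1 S2; rewrite /prim /det /= => pd h1 h2 h3 h4 D0 H.
have H1 := H (s1, 0); have H2 := H (- s1, 0); have H3 := H (0, s2); have H4 := H (0, - s2).
have {}H1 := H1 (or_introl erefl).
have {}H2 := H2 (or_intror (or_introl erefl)).
have {}H3 := H3 (or_intror (or_intror (or_introl erefl))).
have {}H4 := H4 (or_intror (or_intror (or_intror erefl))).
rewrite /= in H1 H2 H3 H4; clear H.
(* If both were nonzero, an axis direction would lie strictly between [d] and [w]; likewise for the
   second coordinate. *)
have A1 : d1 = 0 \/ w1 = 0 by case: S1 S2 => -> [] -> in h1 h2 h3 h4 H1 H2 H3 H4 *; lia.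
have A2 : d2 = 0 \/ w2 = 0 by case: S1 S2 => -> [] -> in h1 h2 h3 h4 H1 H2 H3 H4 *; lia.
clear H1 H2 H3 H4.
have [e1|[e1 e2]] : d1 = 0 \/ (w1 = 0 /\ d2 = 0).
  case: A1 => a1; first by left.
  case: A2 => a2; first by right.
  by exfalso; subst; lia.
  subst d1; move: pd; rewrite coprimez_sym => /prim1 pd.
  case: S1 S2 pd => -> [] -> [] pd in h1 h2 h3 h4 D0 *; subst d2 => //=; exfalso; lia.
subst w1 d2; move: pd => /prim1 pd.
by case: S1 S2 pd => -> [] -> [] pd in h1 h2 h3 h4 D0 *; subst d1 => //=; exfalso; lia.
Qed.

(** * Configurations at a point and their value at the origin *)

Section Counting.

Variables (m n : nat).
Hypotheses (m2 : (2 <= m)%N) (n2 : (2 <= n)%N).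

Local Notation G := ('I_m * 'I_n)%type.
Local Notation W := ('I_m.*2.+1 * 'I_n.*2.+1)%type.
Local Notation nextz z := (succ_dir (@vec m n) (dirs z)).
Local Notation origin := (origin m2 n2).
Implicit Types (x z : G) (t : W).

Definition corner z : bool :=
  [&& (z.1 == 0 :> nat) || (z.1 == m.-1 :> nat) & (z.2 == 0 :> nat) || (z.2 == n.-1 :> nat)].

Definition flips z : {set W} -> {set W} := flip (@vec m n) (@neg_dir m n) (dirs z) (vis z).
Definition bidirs z : {set W} := bidir (@neg_dir m n) (vis z).
Definition halfz z c : {set W} := half_dirs (@vec m n) (@neg_dir m n) (dirs z) c.

Lemma flipsP z t : t \in flips z (dirs z) ->
  [/\ t \in dirs z, t \notin vis z, neg_dir t \in vis z, nextz z t \in vis z &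
      neg_dir (nextz z t) \notin vis z].
Proof.
rewrite mem_flip => /and3P[td tv nv]; have /isnextP[wd _ _] := nextzP m2 n2 td.
by split => //; [move: td | move: wd]; rewrite dirsE ?(negbTE tv) ?(negbTE nv) ?orbF.
Qed.

Lemma flips_noncorner z : ~~ corner z -> flips z (dirs z) = finset.set0.
Proof.
move=> nc; apply/finset.setP => t; rewrite finset.in_set0; apply/negP => /flipsP[td tv ntv wv nwv].
have /isnextP[wd tw _] := nextzP m2 n2 td.
have pt_ := dirs_prim td; have pw := dirs_prim wd.
move: tv ntv wv nwv; rewrite !visN !visE pt_ pw /= => a1 a2 a3 a4.
apply: (no_flip pt_ pw tw (inbox_pt z) a2 a3 a1 a4) => [x|]; first exact: nextz_empty.
move: nc; rewrite /corner /opposite_nbrs /inbox /pt /=.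
by case: z {td a1 a2 a3 a4 tw wd pw} => -[i hi] [j hj] /=; lia.
Qed.

Lemma corner_signs z : corner z -> exists s1 s2 : int,
  [/\ s1 = 1 \/ s1 = - 1, s2 = 1 \/ s2 = - 1,
      forall p : int * int, inbox m n (pt z + p) -> 0 <= s1 * p.1 /\ 0 <= s2 * p.2 &
      inbox m n (pt z + (s1, 0)) /\ inbox m n (pt z + (0, s2))].
Proof.
case: z => -[i hi] [j hj]; rewrite /corner /inbox /pt /= => c.
exists (if i == 0%N then 1 else - 1), (if j == 0%N then 1 else - 1); split.
- by case: ifP; [left|right].
- by case: ifP; [left|right].
- by move=> [a b] /=; case: ifP; case: ifP; lia.
- by case: ifP; case: ifP; lia.
Qed.

(** At a corner P lies in a closed quadrant. A flip leads from the opposite quadrant into this one,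
    so its cone is the whole quadrant in between, and [corner_flip_dir] pins it down. *)
Lemma flips_corner z : corner z -> exists2 t0, flips z (dirs z) = [set t0] &
  forall c, c \in vis z -> t0 \in halfz z c.
Proof.
move=> /corner_signs[s1 [s2 [S1 S2 Hb [b1 b2]]]].
have vb t : t \in vis z -> 0 <= s1 * (vec t).1 /\ 0 <= s2 * (vec t).2.
  by rewrite visE => /andP[_ /Hb].
have vbN t : neg_dir t \in vis z -> s1 * (vec t).1 <= 0 /\ s2 * (vec t).2 <= 0.
  by move/vb; rewrite vec_opp /= !mulrN !oppr_ge0.
pose p0 : int * int := if s1 == s2 then (0, - s2) else (- s1, 0).
have pp0 : prim p0 by rewrite /p0; case: S1 S2 => -> [] ->.
have bp0 : inbox m n (pt z - p0).
  rewrite /p0; case: eqP => _.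
    by rewrite (_ : - (0, - s2) = (0, s2)) // -[LHS]/(_, _) /= opprK oppr0.
  by rewrite (_ : - (- s1, 0) = (s1, 0)) // -[LHS]/(_, _) /= opprK oppr0.
have [E0 v0] := visN_ofvec bp0 pp0.
set t0 := ofvec _ _ _ in E0 v0.
have d0 : t0 \in dirs z by rewrite dirsE v0 orbT.
exists t0.
  apply/finset.setP => t; rewrite finset.in_set1; apply/idP/eqP => [|->].
    move=> /flipsP[td tv ntv wv nwv]; apply: (@vec_inj m n); rewrite E0.
    have /isnextP[wd tw H] := nextzP m2 n2 td.
    have [h1 h2] := vbN _ ntv; have [h3 h4] := vb _ wv.
    apply: (corner_flip_dir S1 S2 (dirs_prim td) h1 h2 h3 h4 tw) => x xx tx xw.
    have /andP[n1 n2'] := nextz_empty m2 n2 td tx xw.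
    case: xx => [e|[e|[e|e]]]; subst x.
    - by rewrite b1 in n1.
    - by rewrite (_ : - (- s1, 0) = (s1, 0)) ?b1 // -[LHS]/(_, _) /= opprK oppr0 in n2'.
    - by rewrite b2 in n1.
    - by rewrite (_ : - (0, - s2) = (0, s2)) ?b2 // -[LHS]/(_, _) /= opprK oppr0 in n2'.
  rewrite mem_flip d0 /=; apply/andP; split; apply/negP.
    move=> /vb; rewrite E0 /p0; case: S1 S2 => -> [] -> /=; lia.
  move=> /vbN; have /isnextP[_ tw _] := nextzP m2 n2 d0; move: tw.
  rewrite E0 /p0 /det; case: (vec _) => w1 w2.
  by case: S1 S2 => -> [] -> /=; lia.
move=> c cv; rewrite mem_half d0 /= -(inj_eq (@vec_inj m n)) !vec_opp E0.
have := vb _ cv; move: cv; rewrite visE => /andP[pc _].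
have prim1 (a : int) : coprimez a 0 -> a = 1 \/ a = - 1.
  by rewrite /coprimez gcdz0 => /eqP; lia.
move: pc; case: (vec c) => c1 c2; rewrite /prim /p0 /det -pair_eqE /= => pc h.
have h0 : c2 = 0 -> c1 = 1 \/ c1 = - 1 by move=> e; apply: prim1; rewrite -e.
have h0' : c1 = 0 -> c2 = 1 \/ c2 = - 1 by move=> e; apply: prim1; rewrite -e coprimez_sym.
by case: S1 S2 h => -> [] -> /=; lia.
Qed.

Lemma card_flips z : #|flips z (dirs z)| = corner z.
Proof.
have [/flips_corner[t0 -> _]|/flips_noncorner ->] := boolP (corner z); first by rewrite cards1.
by rewrite cards0.
Qed.

Lemma card_flips_half z c : c \in vis z -> #|flips z (halfz z c)| = corner z.
Proof.
move=> cv; have E : flips z (halfz z c) = flips z (dirs z) :&: halfz z c.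
  apply/finset.setP => t; rewrite finset.in_setI !mem_flip.
  have := half_sub (@vec m n) (@neg_dir m n) (dirs z) c; rewrite -/(halfz z c) => /fintype.subsetP s.
  by have [/s ->|] := boolP (t \in halfz z c); rewrite ?andbT ?andbF.
rewrite E; have [cz|/flips_noncorner ->] := boolP (corner z); last by rewrite finset.set0I cards0.
have [t0 -> h] := flips_corner cz.
rewrite (finset.setIidPl _) ?cards1 //.
by apply/fintype.subsetP => t; rewrite finset.in_set1 => /eqP ->; exact: h.
Qed.

Lemma bidirs_corner z : corner z -> bidirs z = finset.set0.
Proof.
move=> /corner_signs[s1 [s2 [S1 S2 Hb _]]]; apply/finset.setP => t.
rewrite finset.in_set0 mem_bidir visE visN; apply/negP => /andP[/andP[p /Hb h1] /andP[_ /Hb h2]].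
move: p h1 h2; case: (vec t) => a b; rewrite /prim /= => p h1 h2.
have a0 : a = 0 by case: S1 h1 h2 => ->; lia.
have b0 : b = 0 by case: S2 h1 h2 => ->; lia.
by rewrite a0 b0 in p.
Qed.

Lemma card_corner : (\sum_z (corner z : nat) = 4)%N.
Proof.
have hm : (m.-1 < m)%N by lia.
have hn : (n.-1 < n)%N by lia.
pose A : {set 'I_m} := [set Ordinal (ltnW m2); Ordinal hm].
pose B : {set 'I_n} := [set Ordinal (ltnW n2); Ordinal hn].
have -> : (\sum_z (corner z : nat) = #|finset.setX A B|)%N.
  rewrite -sum1_card [RHS]big_mkcond; apply: eq_bigr => -[i j] _.
  rewrite finset.in_setX /= !inE -!val_eqE /=.
  by rewrite /corner /=; case: ifP.
by rewrite cardsX !cards2 -!val_eqE /=; case: m n m2 n2 => [|[|?]] [|[|?]].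
Qed.

Definition prim_dir z : int * int :=
  ((z.1 %/ gcdn z.1 z.2)%N%:Z, (z.2 %/ gcdn z.1 z.2)%N%:Z).

Definition origin_dir z : W := ofvec m n (- prim_dir z).

Lemma gcdn_gt0_origin z : z != origin -> (0 < gcdn z.1 z.2)%N.
Proof.
move=> nz; rewrite gcdn_gt0 !lt0n -negb_and; apply: contra nz => /andP[/eqP e1 /eqP e2].
by apply/eqP; apply: pt_inj; rewrite /pt e1 e2.
Qed.

Lemma coprime_div_gcdn a b : (0 < gcdn a b)%N -> coprime (a %/ gcdn a b) (b %/ gcdn a b).
Proof.
move=> g0; rewrite /coprime -(eqn_pmul2l g0) muln_gcdr muln1.
by rewrite !(mulnC (gcdn a b)) !divnK ?dvdn_gcdl ?dvdn_gcdr.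
Qed.

Lemma origin_dirP z : z != origin -> [/\ origin_dir z \in vis z,
  vec (origin_dir z) = - prim_dir z &
  exists2 g : int, 0 < g & pt z = (g * (prim_dir z).1, g * (prim_dir z).2)].
Proof.
move=> nz; have g0 := gcdn_gt0_origin nz.
have pp : prim (- prim_dir z) by rewrite primN /prim /prim_dir /= coprimezE; exact: coprime_div_gcdn.
have bp : inbox m n (pt z + - prim_dir z).
  have := inbox_pt z; rewrite /inbox /pt /prim_dir /=.
  have := leq_div z.1 (gcdn z.1 z.2); have := leq_div z.2 (gcdn z.1 z.2).
  by move: (_ %/ _)%N (_ %/ _)%N => a b; lia.
have [E v] := vis_ofvec bp pp; split => //.
exists (gcdn z.1 z.2)%:Z; first by lia.
by rewrite /pt /prim_dir /= -!PoszM !(mulnC (gcdn _ _)) !divnK ?dvdn_gcdl ?dvdn_gcdr.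
Qed.

(** Let c point from z to the origin. The value there is decided by the sign of [det c w + det c t]
    with w = succ t. By the empty sectors the two terms do not have opposite signs; if t = c or t =
    -c, unimodularity settles the sign. *)
Lemma origin_half z t : z != origin -> t \in confs z ->
  (conf_fun (z, t) origin == false) = (t \in halfz z (origin_dir z)).
Proof.
move=> nz tc; have [cv Ec [g g0 Ez]] := origin_dirP nz.
have [ o1 [ o2 [E1 E2 D1 H EF]]] := confs_spec m2 n2 tc.
have tv : t \in vis z by case/confsP: tc.
have td : t \in dirs z by rewrite dirsE tv.
have := H origin; rewrite E1 E2 ffunE /= mem_half td /= -(inj_eq (@vec_inj m n)) !vec_opp.
rewrite E1 E2 in D1; have pt_ := dirs_prim td.
have E0 : pt origin - pt z = (g * (vec (origin_dir z)).1, g * (vec (origin_dir z)).2).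
  by rewrite Ez Ec /pt /= -[LHS]/(_, _) /= !sub0r !mulrN.
have pc : prim (vec (origin_dir z)) by move: cv; rewrite visE => /andP[].
rewrite E0; move: (vec (origin_dir z)) (vec (nextz z t)) D1 pc => c w D1 pc.
have S a : det (g * c.1, g * c.2) a = g * det c a by rewrite /det /=; ring.
rewrite !S -mulrDr pmulr_rgt0 // !pmulr_rle0 // !pmulr_rge0 // detNl oppr_gt0.
have [e|ne] := eqVneq (vec t) (- c).
  rewrite e in D1 *; rewrite detNr det_refl oppr0 addr0; rewrite detNl in D1.
  by move: D1; move: (det c w) => a; lia.
move=> h; rewrite orFb.
have [dt|dt] := eqVneq (det c (vec t)) 0; last by move: h dt; move: (det c w) (det c _) => a b; lia.
have [e|e] := prim_collinear pc pt_ dt; last by rewrite e eqxx in ne.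
rewrite -e D1 det_refl; lia.
Qed.

Lemma card_pairs (A : {set G * W}) : #|A| = (\sum_z #|[set t | (z, t) \in A]|)%N.
Proof.
rewrite -sum1_card big_mkcond /= (eq_bigl predT) //.
under [RHS]eq_bigr => z _ do rewrite -sum1_card big_mkcond /=.
rewrite pair_bigA /=; apply: eq_bigr => -[z t] _ /=; by rewrite inE.
Qed.

Lemma card_confs z : #|confs z| = (corner z + #|bidirs z|)%N.
Proof.
rewrite -card_flips; apply: card_conf_full => //.
- exact: vec_inj.
- exact: vec_opp.
- exact: dirs_opp.
- exact: dirs_prim.
- exact: dirs_span.
- exact: dirsE.
Qed.

Lemma card_conf_set : #|conf_set m n| = (4 + \sum_z #|bidirs z|)%N.
Proof.
rewrite card_pairs -card_corner -big_split /=; apply: eq_bigr => z _.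
rewrite -card_confs; congr #|pred_of_set _|; apply/finset.setP => t.
by rewrite finset.in_set mem_conf_set.
Qed.

Definition last_on_ray z : bool := (z != origin) && ~~ inbox m n (pt z + prim_dir z).

(** [card_conf_half] for the direction c from z to the origin: -c leaves the grid exactly when z is
    last on its ray. *)
Lemma card_conf_origin z :
  (2 * #|[set t in confs z | conf_fun (z, t) origin == false]| + 2 * last_on_ray z =
   #|bidirs z| + 2 * corner z)%N.
Proof.
have [->|nz] := eqVneq z origin.
  (* At z = origin every configuration function vanishes at z itself. *)
  rewrite /last_on_ray eqxx /= (_ : [set t in _ | _] = confs origin).
    rewrite card_confs bidirs_corner ?cards0; last by rewrite /corner.
    by rewrite (_ : corner origin) // /corner.
  apply/finset.setP => t; rewrite [LHS]inE; apply: andb_idr => tc.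
  by rewrite ffunE /= subrr /det !mul0r subrr.
have [cv Ec _] := origin_dirP nz.
have -> : [set t in confs z | conf_fun (z, t) origin == false] =
    conf (@vec m n) (@neg_dir m n) (dirs z) (vis z) (halfz z (origin_dir z)).
  apply/finset.setP => t; rewrite mem_conf; apply/finset.setIdP/idP.
    move=> [tc]; rewrite origin_half // => ->; case/confsP: tc => -> ->.
    by [].
  move=> /and3P[th tv nv]; have tc : t \in confs z by apply/confsP.
  by rewrite origin_half.
have := card_conf_half (@vec_inj m n) (@vec_opp m n) (@dirs_opp m n z) (@dirs_prim m n z)
  (dirs_span m2 n2 (z := z)) (dirsE z) cv.
rewrite -/(halfz z (origin_dir z)) -/(flips z _) card_flips_half // -/(bidirs z).
rewrite /last_on_ray nz /= visN Ec opprK.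
have -> : prim (- prim_dir z) by move: cv; rewrite visE Ec => /andP[].
by case: (inbox _ _ _) => /=; move: #|_| #|_| (nat_of_bool _) => a b c; lia.
Qed.

End Counting.

(** * Rays from the origin and coprime pairs *)

Section Rays.

Variables (m n : nat).
Hypotheses (m2 : (2 <= m)%N) (n2 : (2 <= n)%N).

Local Notation G := ('I_m * 'I_n)%type.
Implicit Types (p z : G).

Definition prim_pt z : G :=
  (Ordinal (leq_ltn_trans (leq_div z.1 (gcdn z.1 z.2)) (ltn_ord z.1)),
   Ordinal (leq_ltn_trans (leq_div z.2 (gcdn z.1 z.2)) (ltn_ord z.2))).

Lemma pt_prim_pt z : pt (prim_pt z) = prim_dir z.
Proof. by []. Qed.

(** Of two different multiples of a primitive vector in the box, the smaller can be extended by that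
    vector without leaving the box. *)
Lemma last_on_ray_inj : {in [pred z | last_on_ray m2 n2 z] &, injective prim_pt}.
Proof.
move=> z z'; rewrite !inE => /andP[nz bz] /andP[nz' bz'] e.
have e' : prim_dir z' = prim_dir z by rewrite -!pt_prim_pt e.
have [_ _ [g g0 E]] := origin_dirP nz; have [_ _ [g' g0' E']] := origin_dirP nz'.
apply: pt_inj; rewrite e' in bz' E'.
have [a0 b0] : 0 <= (prim_dir z).1 /\ 0 <= (prim_dir z).2 by [].
have := inbox_pt z; have := inbox_pt z'; move: bz bz'; rewrite E E'.
move: (prim_dir z) a0 b0 => [a b] /=; rewrite /inbox /= => a0 b0 bz bz' h h'.
case: (ltgtP g g') => [lt|lt|-> //]; exfalso.
  have ha : g * a + a <= g' * a by nia.
  have hb : g * b + b <= g' * b by nia.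
  have ha' : 0 <= g * a by nia.
  have hb' : 0 <= g * b by nia.
  by lia.
have ha : g' * a + a <= g * a by nia.
have hb : g' * b + b <= g * b by nia.
have ha' : 0 <= g' * a by nia.
have hb' : 0 <= g' * b by nia.
by lia.
Qed.

Lemma last_on_ray_surj p : coprime p.1 p.2 ->
  exists2 z, last_on_ray m2 n2 z & prim_pt z = p.
Proof.
move=> cp; pose P k := ((k * p.1 < m) && (k * p.2 < n))%N.
have P1 : P 1%N by rewrite /P !mul1n !ltn_ord.
have p0 : (0 < p.1 + p.2)%N.
  by rewrite lt0n addn_eq0; apply/negP => /andP[/eqP e1 /eqP e2]; rewrite e1 e2 in cp.
have Pb k : P k -> (k <= m + n)%N by move=> /andP[h1 h2]; nia.
have exP : exists k, P k by exists 1%N.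
have [k /andP[k1 k2] kmax] := ex_maxnP exP Pb.
have k0 : (0 < k)%N := kmax _ P1.
have Pk : ~~ P k.+1 by apply/negP => /kmax; rewrite ltnn.
pose z : G := (Ordinal k1, Ordinal k2).
have gz : gcdn z.1 z.2 = k by rewrite /= -muln_gcdr (eqP cp) muln1.
have ez : prim_pt z = p.
  by apply: pt_inj; rewrite /pt /prim_pt /= -/(gcdn z.1 z.2) gz !mulKn.
exists z => //; rewrite /last_on_ray -pt_prim_pt ez; apply/andP; split.
  apply/eqP => /(congr1 (@pt m n)) [e1 e2]; move: p0 e1 e2; clear -k0; nia.
by apply: contra Pk; rewrite /inbox /pt /P /=; lia.
Qed.

(** Rays correspond to coprime pairs; the extra 2 counts (1, 0) and (0, 1), the two axes. *)
Lemma sum_last_on_ray : (\sum_z (last_on_ray m2 n2 z : nat) = s m n + 2)%N.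
Proof.
have -> : (\sum_z (last_on_ray m2 n2 z : nat) = #|[set z | last_on_ray m2 n2 z]|)%N.
  rewrite -sum1_card [RHS]big_mkcond; apply: eq_bigr => z _.
  by rewrite finset.in_set; case: last_on_ray.
rewrite -(card_in_imset (f := prim_pt)); last first.
  by move=> z z'; rewrite !finset.in_set => h h'; apply: last_on_ray_inj.
have -> : prim_pt @: [set z | last_on_ray m2 n2 z] = [set p : G | coprime p.1 p.2].
  apply/finset.setP => p; rewrite finset.in_set; apply/imsetP/idP => [[z]|/last_on_ray_surj[z h <-]].
    rewrite finset.in_set => /andP[nz _] ->.
    exact: coprime_div_gcdn (gcdn_gt0_origin nz).
  by exists z; rewrite // finset.in_set.
pose e1 : G := (Ordinal m2, Ordinal (ltnW n2)).
pose e2 : G := (Ordinal (ltnW m2), Ordinal n2).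
have -> : [set p : G | coprime p.1 p.2] =
   e1 |: (e2 |: [set p : G | [&& (0 < p.1)%N, (0 < p.2)%N & coprime p.1 p.2]]).
  apply/finset.setP => -[[i hi] [j hj]]; rewrite !inE -!pair_eqE /= -!val_eqE /=.
  case: i hi => [|i] hi; case: j hj => [|j] hj //=; rewrite ?andbF ?orbF //.
  by rewrite /coprime gcdn0 andbT.
rewrite !cardsU1 !inE /=.
by rewrite addnA addnC.
Qed.

End Rays.

(** Sum of [card_conf_origin] over z: the four corners contribute 8 and the two axes take away 4. *)
Lemma u_false_one (R : realType) m n : (2 <= m)%N -> (2 <= n)%N ->
  (2 * u R m n false 1 + 2 * s m n = \sum_(z : 'I_m * 'I_n) #|bidirs z| + 4)%N.
Proof.
move=> m2 n2; rewrite (u_one R m2 n2) card_pairs.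
have E : (\sum_z #|[set t | (z, t) \in [set c in conf_set m n | conf_fun c (origin m2 n2) == false]]| =
   \sum_z #|[set t in confs z | conf_fun (z, t) (origin m2 n2) == false]|)%N.
  apply: eq_bigr => z _; congr #|pred_of_set _|; apply/finset.setP => t.
  by rewrite finset.in_set; apply/finset.setIdP/finset.setIdP; rewrite mem_conf_set.
have := sum_last_on_ray m2 n2; have := card_corner m2 n2; rewrite E.
pose K z := #|[set t in confs z | conf_fun (z, t) (origin m2 n2) == false]|.
pose l z : nat := last_on_ray m2 n2 z.
have : (\sum_z (K z + K z + (l z + l z)) =
    \sum_(z : 'I_m * 'I_n) (#|bidirs z| + (corner z + corner z)))%N.
  apply: eq_bigr => z _; have := card_conf_origin m2 n2 z; rewrite -/(K z) -/(l z).
  by move: (K z) (l z) #|_| (corner z : nat) => a b c d; lia.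
rewrite !big_split /= -/(K _) => h1 h2 h3.
rewrite -[X in (2 * X)%N]/(\sum_z K z)%N; rewrite -/(l _) in h3.
by move: h1 h2 h3; move: (\sum_z K z)%N (\sum_z l z)%N (\sum_z #|_|)%N (\sum_z _)%N => a b c d; lia.
Qed.

(** Complementary count within [conf_set]. *)
Lemma u_true_one (R : realType) m n : (2 <= m)%N -> (2 <= n)%N ->
  (2 * u R m n true 1 = \sum_(z : 'I_m * 'I_n) #|bidirs z| + 4 + 2 * s m n)%N.
Proof.
move=> m2 n2; have := u_false_one R m2 n2; have := card_conf_set m2 n2.
rewrite !(u_one R m2 n2).
rewrite -(cardsID [set c | conf_fun c (origin m2 n2) == false] (conf_set m n)).
have -> : conf_set m n :&: [set c | conf_fun c (origin m2 n2) == false] =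
  [set c in conf_set m n | conf_fun c (origin m2 n2) == false].
  by apply/finset.setP => c; rewrite !inE.
have -> : conf_set m n :\: [set c | conf_fun c (origin m2 n2) == false] =
  [set c in conf_set m n | conf_fun c (origin m2 n2) == true].
  by apply/finset.setP => c; rewrite !inE andbC; case: (conf_fun _ _).
by move: #|_| #|_| (\sum_z _)%N => a b c; lia.
Qed.

(** * Sums over segments with a lattice midpoint *)

Lemma card_ord_seg m k : #|[set i : 'I_m | (k <= i)%N && (i + k < m)%N]| = (m - 2 * k)%N.
Proof.
rewrite -sum1_card big_mkcond /=.
under eq_bigr => i _ do rewrite finset.in_set.
rewrite -(big_mkord predT (fun i => if (k <= i)%N && (i + k < m)%N then 1 else 0)%N) /=.
have [km|km] := leqP (2 * k) m; last first.
  by rewrite big1_seq => [|i _]; [lia | case: ifP => //; lia].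
rewrite (big_cat_nat (n := k)) //=; last by lia.
rewrite [X in (X + _)%N]big_nat_cond big1 ?add0n; last by move=> i h; rewrite ifN //; lia.
rewrite (big_cat_nat (n := m - k)) //=; [|lia|lia].
rewrite [X in (_ + X)%N = _](_ : _ = 0%N) ?addn0; last first.
  by rewrite big_nat_cond big1 // => i h; rewrite ifN //; lia.
rewrite big_nat_cond (eq_bigr (fun=> 1%N)); last by move=> i h; rewrite ifT //; lia.
by rewrite -big_nat_cond sum_nat_const_nat; lia.
Qed.

Lemma fsum_image (R : realType) (W : finType) (e : W -> int * int) (S : {set W})
    (F : int * int -> R) (A : set (int * int)) : injective e ->
  (forall p, A p <-> exists2 t, t \in S & p = e t) ->
  \sum_(p \in A) F p = \sum_(t in S) F (e t).
Proof.
move=> ie HA; have -> : A = [set` [seq e t | t <- enum S]]%classic.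
  apply/seteqP; split => p /=.
    by move=> /HA[t tS ->]; apply/mapP; exists t; rewrite ?mem_enum.
  by move=> /mapP[t]; rewrite mem_enum => tS ->; apply/HA; exists t.
by rewrite -fsbig_seq ?map_inj_uniq ?enum_uniq // big_map big_enum.
Qed.

Section SegmentSum.

Variables (R : realType) (m n : nat).

Local Notation W := ('I_m.*2.+1 * 'I_n.*2.+1)%type.

Definition short_dirs : {set W} :=
  [set t | [&& prim (vec t), 2 * `|(vec t).1| < m%:Z & 2 * `|(vec t).2| < n%:Z]].

Lemma mem_short_dirs t : (t \in short_dirs) =
  [&& prim (vec t), 2 * `|(vec t).1| < m%:Z & 2 * `|(vec t).2| < n%:Z].
Proof. by rewrite inE. Qed.

Lemma card_midpoints (a b : int) :
  #|[set z : 'I_m * 'I_n | inbox m n (pt z + (a, b)) && inbox m n (pt z - (a, b))]|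
  = ((m - 2 * `|a|) * (n - 2 * `|b|))%N.
Proof.
rewrite -!card_ord_seg -cardsX; apply: eq_card => -[i j].
rewrite finset.in_setX !finset.in_set /inbox /pt /=.
by have := ltn_ord i; have := ltn_ord j; move: (i : nat) (j : nat) => k l; lia.
Qed.

(** Double counting of pairs (z, t) with z the midpoint of a segment; for directions that are not
    short a factor truncates to 0. *)
Lemma sum_bidirs : (\sum_(z : 'I_m * 'I_n) #|bidirs z| =
  \sum_(t in short_dirs) (m - 2 * `|(vec t).1|) * (n - 2 * `|(vec t).2|))%N.
Proof.
transitivity (\sum_(z : 'I_m * 'I_n) \sum_t (if t \in bidirs z then 1 else 0))%N.
  by apply: eq_bigr => z _; rewrite -sum1_card big_mkcond.
rewrite exchange_big [RHS]big_mkcond; apply: eq_bigr => t _.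
rewrite mem_short_dirs.
have [pt_|npt] := boolP (prim (vec t)); last first.
  by rewrite big1 // => z _; rewrite mem_bidir visE visN (negbTE npt).
transitivity #|[set z : 'I_m * 'I_n | inbox m n (pt z + vec t) && inbox m n (pt z - vec t)]|.
  rewrite -sum1_card [RHS]big_mkcond /=; apply: eq_bigr => z _.
  by rewrite mem_bidir visE visN pt_ finset.in_set.
case: (vec t) => a b; rewrite card_midpoints /=; case: ifP => // h.
have [->|->] : (m - 2 * `|a| = 0)%N \/ (n - 2 * `|b| = 0)%N by lia.
  by rewrite mul0n.
by rewrite muln0.
Qed.

Lemma sum_bidirsE : (\sum_(z : 'I_m * 'I_n) #|bidirs z|)%:R =
  \sum_(t in short_dirs) (m%:R - 2 * `|(vec t).1%:~R|) * (n%:R - 2 * `|(vec t).2%:~R|) :> R.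
Proof.
rewrite sum_bidirs natr_sum; apply: eq_bigr => t; rewrite mem_short_dirs => /and3P[_ h1 h2].
have E (k : nat) (a : int) : 2 * `|a| < k%:Z ->
    (k - 2 * `|a|)%N%:R = k%:R - 2 * `|a%:~R| :> R.
  move=> h; rewrite natrB; last by lia.
  by rewrite natrM -intr_norm -abszE pmulrn.
by rewrite natrM !E.
Qed.

(** The factor 4 clears the halves: 4 (m/2 - |i|)(n/2 - |j|) = (m - 2|i|)(n - 2|j|). *)
Lemma f_one_half : 4 * f 1 (m%:R / 2 : R) (n%:R / 2) = (\sum_(z : 'I_m * 'I_n) #|bidirs z|)%:R.
Proof.
rewrite sum_bidirsE /f (fsum_image (S := short_dirs) _ (@vec_inj m n)).
  rewrite big_distrr /=; apply: eq_bigr => t _.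
  by rewrite mulrA; field.
have bd (k : nat) (a : int) : (- (k%:R / 2) < (a%:~R : R) < k%:R / 2) <-> 2 * `|a| < k%:Z.
  rewrite -(ltr_int R) intrM intr_norm -[k%:~R]pmulrn.
  rewrite -ltr_norml; split; rewrite ltr_pdivlMr //; by rewrite mulrC.
move=> [a b]; split=> [[/= /bd h1 /bd h2 h3]|[t]].
  have E : vec (ofvec m n (a, b)) = (a, b) by apply: ofvecK => /=; lia.
  by exists (ofvec m n (a, b)); rewrite ?E // mem_short_dirs E /prim /coprimez h3 h1 h2.
rewrite mem_short_dirs => /and3P[p h1 h2] ->; split; [exact/bd|exact/bd|].
exact/eqP.
Qed.

(** The pairs of gcd 2 are the doubles of the coprime pairs. *)
Lemma f_two : f 2 (m%:R : R) n%:R = (\sum_(z : 'I_m * 'I_n) #|bidirs z|)%:R.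
Proof.
pose e (t : W) : int * int := (2 * (vec t).1, 2 * (vec t).2).
have ei : injective e.
  move=> t t' E; apply: vec_inj; have := congr1 fst E; have := congr1 snd E.
  by rewrite /e; case: (vec t) => a b; case: (vec t') => c d /= h1 h2; congr pair; lia.
rewrite sum_bidirsE /f (fsum_image (S := short_dirs) _ ei).
  by apply: eq_bigr => t _; rewrite /e /= !intrM !normrM /= ger0_norm.
have bd (k : nat) (a : int) : (- k%:R < ((2 * a)%:~R : R) < k%:R) <-> 2 * `|a| < k%:Z.
  by rewrite -(ltr_int R) !intrM intr_norm -[k%:~R]pmulrn -ltr_norml normrM ger0_norm.
have M x y : gcdz (2 * x) (2 * y) = 2 * gcdz x y by rewrite -mulz_gcdr.
move=> [a b]; split=> [[/= h1 h2 h3]|[t]].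
  have /dvdzP[c ec] : (2 %| a)%Z by rewrite -[2]h3 dvdz_gcdl.
  have /dvdzP[d ed] : (2 %| b)%Z by rewrite -[2]h3 dvdz_gcdr.
  rewrite mulrC in ec; rewrite mulrC in ed; subst a b.
  move: h1 h2 => /bd h1 /bd h2.
  have E : vec (ofvec m n (c, d)) = (c, d) by apply: ofvecK => /=; lia.
  exists (ofvec m n (c, d)); rewrite /e ?E // mem_short_dirs E /prim /coprimez h1 h2 !andbT /=.
  by apply/eqP; apply: (mulfI (isT : 2 != 0 :> int)); rewrite mulr1 -M.
rewrite mem_short_dirs => /and3P[p h1 h2] ->; split; [exact/bd|exact/bd|].
by rewrite /= M (eqP p).
Qed.

End SegmentSum.

(** * The Basel problem *)

Section Basel.

Variable R : realType.
Implicit Types x : R.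

Lemma sin_le_id x : 0 < x -> sin x <= x.
Proof.
move=> x0; have cs : {within `[0, x], continuous (@sin R)}%classic.
  by apply: continuous_subspaceT => y; exact: continuous_sin.
have [c _] := MVT x0 (fun y _ => is_derive_sin y) cs.
rewrite sin0 !subr0 => ->; rewrite ler_piMl ?cos_le1 //; exact: ltW.
Qed.

Lemma tan_ge_id x : 0 < x < pi / 2 -> x <= tan x.
Proof.
move=> /andP[x0 x1].
have cy y : 0 <= y <= x -> 0 < cos y.
  move=> /andP[y0 yx]; apply: cos_gt0_pihalf; rewrite (le_lt_trans yx x1) andbT.
  by rewrite (lt_le_trans _ y0) // oppr_lt0 divr_gt0 // pi_gt0.
have ct : {within `[0, x], continuous (@tan R)}%classic.
  apply: continuous_in_subspaceT => y; rewrite inE /= in_itv /= => yx.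
  by apply: continuous_tan; rewrite gt_eqF // cy.
have dt y : y \in `]0, x[ -> is_derive y 1 (@tan R) ((cos y) ^- 2).
  rewrite in_itv /= => /andP[y0 yx]; apply: is_derive_tan.
  by rewrite gt_eqF // cy // !ltW.
have [c cx] := MVT x0 dt ct.
rewrite tan0 !subr0 => ->; rewrite ler_peMl ?(ltW x0) //.
have c0 : 0 < cos c.
  by move: cx; rewrite in_itv /= => /andP[c0 cx]; rewrite cy // !ltW.
rewrite invf_ge1 ?exprn_gt0 // expr_le1 ?cos_le1 //; exact: ltW.
Qed.

(** From sin x <= x <= tan x and 1/sin^2 = 1/tan^2 + 1. *)
Lemma inv_sin2_bounds x : 0 < x < pi / 2 ->
  x ^- 2 <= sin x ^- 2 <= x ^- 2 + 1.
Proof.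
move=> xb; have /andP[x0 x1] := xb.
have s0 := sin_gt0_pihalf xb.
have c0 : 0 < cos x.
  by apply: cos_gt0_pihalf; rewrite x1 andbT (lt_trans _ x0) // oppr_lt0 divr_gt0 ?pi_gt0.
apply/andP; split.
  by rewrite lef_pV2 ?posrE ?exprn_gt0 // lerXn2r ?nnegrE ?(ltW s0) ?(ltW x0) // sin_le_id.
have xt := tan_ge_id xb.
have -> : sin x ^- 2 = tan x ^- 2 + 1.
  rewrite /tan expr_div_n invf_div -[1](mulfV (x := sin x ^+ 2)).
    by rewrite -mulrDl cos2Dsin2 mul1r.
  by rewrite expf_neq0 // gt_eqF.
rewrite lerD2r lef_pV2 ?posrE ?exprn_gt0 ?(lt_le_trans x0 xt) //.
by rewrite lerXn2r ?nnegrE ?(ltW x0) // (le_trans (ltW x0) xt).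
Qed.

Lemma inv_sin2_double x : sin x != 0 -> cos x != 0 ->
  sin (x *+ 2) ^- 2 = (sin x ^- 2 + sin (pi / 2 - x) ^- 2) / 4.
Proof.
move=> s0 c0; have -> : sin (pi / 2 - x) = cos x.
  by rewrite sinB sin_pihalf cos_pihalf mul1r mul0r subr0.
rewrite sin_mulr2n.
have := cos2Dsin2 x; move: (cos x) (sin x) c0 s0 => c s c0 s0 h.
rewrite -mulr_natl !exprMn.
have -> : s ^- 2 + c ^- 2 = 1 / (s ^+ 2 * c ^+ 2).
  by rewrite -h; field; rewrite s0 c0.
by field; rewrite s0 c0.
Qed.

Definition odd_angle (j k : nat) : R := k.*2.+1%:R * pi / (2 ^ j.+2)%:R.

Lemma odd_angle_bounds j k : (k < 2 ^ j)%N -> 0 < odd_angle j k < pi / 2.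
Proof.
move=> kj; have p0 := pi_gt0 R; rewrite /odd_angle divr_gt0 ?mulr_gt0 ?ltr0n ?expn_gt0 //=.
rewrite ltr_pdivrMr ?ltr0n ?expn_gt0 // mulrC -mulrA ltr_pM2l //.
rewrite ltr_pdivlMl // -natrM ltr_nat !expnS; lia.
Qed.

(** By [inv_sin2_double], each angle of level j splits into its half and the complement of its half
    at level j + 1, so the sum is multiplied by 4. *)
Lemma sum_inv_sin2 j : \sum_(0 <= k < 2 ^ j) sin (odd_angle j k) ^- 2 = 2 * 4 ^+ j.
Proof.
elim: j => [|j IH].
  rewrite big_nat1 /odd_angle mul1r expr0 mulr1.
  have e : (pi / (2 ^ 2)%:R) *+ 2 = pi / 2 :> R by rewrite -mulr_natr; field.
  have := cos2Dsin2 (pi / (2 ^ 2)%:R : R).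
  have := cos_mulr2n (pi / (2 ^ 2)%:R : R); rewrite e cos_pihalf => h1 h2.
  have -> : sin (pi / (2 ^ 2)%:R : R) ^+ 2 = 2^-1.
    move: h1 h2; rewrite -mulr_natl => h1 h2; lra.
  by rewrite invrK.
rewrite exprS mulrCA -{}IH.
rewrite (big_cat_nat (n := 2 ^ j)) //=; last by rewrite leq_exp2l.
(* Reversing the upper half of the range pairs each angle with its complement. *)
have -> : \sum_(2 ^ j <= i < 2 ^ j.+1) sin (odd_angle j.+1 i) ^- 2 =
    \sum_(0 <= i < 2 ^ j) sin (odd_angle j.+1 (2 ^ j.+1 - i.+1)) ^- 2.
  rewrite big_nat_rev /= -{1}[(2 ^ j)%N]add0n big_addn.
  have -> : (2 ^ j.+1 - 2 ^ j = 2 ^ j)%N by rewrite expnS; lia.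
  apply: eq_big_nat => i /andP[_ ij]; congr (sin (odd_angle _ _) ^- 2).
  by rewrite expnS; lia.
rewrite -big_split big_distrr /=; apply: eq_big_nat => k /andP[_ kj].
have e1 : odd_angle j k = odd_angle j.+1 k *+ 2.
  rewrite /odd_angle -mulr_natr [(2 ^ j.+3)%N]expnS natrM.
  by field; rewrite pnatr_eq0 expn_eq0.
have e2 : odd_angle j.+1 (2 ^ j.+1 - k.+1) = pi / 2 - odd_angle j.+1 k.
  rewrite /odd_angle.
  have -> : ((2 ^ j.+1 - k.+1).*2.+1 = 2 ^ j.+2 - k.*2.+1)%N.
    by rewrite ![(2 ^ _.+1)%N]expnS; lia.
  rewrite natrB; last by rewrite ![(2 ^ _.+1)%N]expnS; lia.
  rewrite [(2 ^ j.+3)%N]expnS natrM.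
  by field; rewrite pnatr_eq0 expn_eq0.
have kj1 : (k < 2 ^ j.+1)%N by rewrite expnS; lia.
have b := odd_angle_bounds kj1; have /andP[b0 b1] := b.
rewrite e1 e2 inv_sin2_double; first by rewrite [RHS]mulrC divfK.
  by rewrite gt_eqF // sin_gt0_pihalf.
by rewrite gt_eqF // cos_gt0_pihalf // b1 andbT (lt_trans _ b0) // oppr_lt0 divr_gt0 ?pi_gt0.
Qed.

Definition odd_sum (q : nat) : R := \sum_(0 <= k < q) k.*2.+1%:R ^- 2.

Lemma odd_sum_bounds j :
  pi ^+ 2 / 8 - pi ^+ 2 / (16 * 2 ^+ j) <= odd_sum (2 ^ j) <= pi ^+ 2 / 8.
Proof.
have p0 := pi_gt0 R; have t0 : 0 < 2 ^+ j :> R by rewrite exprn_gt0.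
have q0 : 4 ^+ j != 0 :> R by rewrite expf_neq0.
have pn : pi != 0 :> R by rewrite gt_eqF.
(* Chosen so that [odd_angle j k ^- 2] is [c] times the term of index k in [odd_sum]. *)
pose c : R := 16 * 4 ^+ j / pi ^+ 2.
have c0 : 0 < c by rewrite divr_gt0 ?mulr_gt0 ?exprn_gt0.
have E : c * odd_sum (2 ^ j) = \sum_(0 <= k < 2 ^ j) odd_angle j k ^- 2.
  rewrite /odd_sum big_distrr /=; apply: eq_big_nat => k _.
  rewrite /odd_angle !exprMn exprVn natrX -exprM mulnC exprM /c.
  have -> : (2 ^+ 2) ^+ j.+2 = 16 * 4 ^+ j :> R by rewrite -natrX !exprS; ring.
  have : k.*2.+1%:R != 0 :> R by rewrite pnatr_eq0.
  move: k.*2.+1%:R q0 pn => a + + a0; move: (4 ^+ j) (pi : R) => b p b0 p0'.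
  by field; rewrite a0 b0 p0'.
have L : c * odd_sum (2 ^ j) <= 2 * 4 ^+ j.
  rewrite E -sum_inv_sin2; apply: ler_sum_nat => k /andP[_ kj].
  by have /andP[] := inv_sin2_bounds (odd_angle_bounds kj).
have U : 2 * 4 ^+ j <= c * odd_sum (2 ^ j) + 2 ^+ j.
  rewrite E -sum_inv_sin2.
  have -> : 2 ^+ j = \sum_(0 <= k < 2 ^ j) 1 :> R.
    by rewrite big_const_nat subn0 iter_addr addr0 -natrX.
  rewrite -big_split /=; apply: ler_sum_nat => k /andP[_ kj].
  by have /andP[] := inv_sin2_bounds (odd_angle_bounds kj).
have e4 : 4 ^+ j = 2 ^+ j * 2 ^+ j :> R by rewrite -exprMn; congr (_ ^+ j); lra.
rewrite -(ler_pM2l c0) -[X in _ && X](ler_pM2l c0).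
have -> : c * (pi ^+ 2 / 8 - pi ^+ 2 / (16 * 2 ^+ j)) = 2 * 4 ^+ j - 2 ^+ j.
  rewrite /c e4; move: pn t0; move: (pi : R) (2 ^+ j) => p t pn /lt0r_neq0 t0.
  by field; rewrite pn t0.
have -> : c * (pi ^+ 2 / 8) = 2 * 4 ^+ j by rewrite /c; move: pn; move: (pi : R) => p pn; field.
by rewrite lerBlDr U.
Qed.

Lemma le_archi (x y C : R) : (forall j : nat, x <= y + C / j.+1%:R) -> x <= y.
Proof.
move=> H; rewrite leNgt; apply/negP => yx.
have e0 : 0 < x - y by rewrite subr_gt0.
have [j hj] : exists j : nat, C / (x - y) < j.+1%:R.
  by exists (Num.truncn (C / (x - y))); exact: truncnS_gt.
have := H j; rewrite -lerBlDl leNgt; apply/negP/negPn.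
by rewrite ltr_pdivrMr ?ltr0n // -ltr_pdivrMl // mulrC.
Qed.

Definition inv_sq_sum (q : nat) : R := \sum_(1 <= k < q.+1) k%:R ^- 2.

(** Telescoping with 1/(k + 1)^2 <= 1/k - 1/(k + 1). *)
Lemma inv_sq_tail p q : (0 < p)%N -> (p <= q)%N ->
  \sum_(p.+1 <= k < q.+1) k%:R ^- 2 <= p%:R^-1 - q%:R^-1 :> R.
Proof.
move=> p0; elim: q => [|q IH]; first by lia.
rewrite leq_eqVlt => /orP[/eqP <-|pq]; first by rewrite big_geq // subrr.
rewrite big_nat_recr //=.
have q0 : 0 < q%:R :> R by rewrite ltr0n; lia.
apply: le_trans (lerD (IH pq) (lexx _)) _.
rewrite -addrA lerD2l -natr1.
have -> : - q%:R^-1 + (q%:R + 1) ^- 2 = - (q%:R + 1)^-1 - (q%:R * (q%:R + 1) ^+ 2)^-1 :> R.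
  by field; rewrite !gt_eqF // addr_gt0.
by rewrite gerBl invr_ge0 mulr_ge0 ?exprn_ge0 ?addr_ge0 ?ltW.
Qed.

Lemma inv_sq_sum_cat p q : (p <= q)%N ->
  inv_sq_sum q = inv_sq_sum p + \sum_(p.+1 <= k < q.+1) k%:R ^- 2.
Proof. by move=> pq; rewrite /inv_sq_sum (big_cat_nat (n := p.+1)). Qed.

Lemma inv_sq_sum_le p q : (p <= q)%N -> inv_sq_sum p <= inv_sq_sum q.
Proof.
by move=> pq; rewrite (inv_sq_sum_cat pq) lerDl sumr_ge0 // => k _; rewrite invr_ge0 exprn_ge0.
Qed.

Lemma inv_sq_sumS q : inv_sq_sum q.+1 = inv_sq_sum q + q.+1%:R ^- 2.
Proof. by rewrite /inv_sq_sum big_nat_recr. Qed.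

Lemma inv_sq_sum_double q : inv_sq_sum q.*2 = odd_sum q + inv_sq_sum q / 4.
Proof.
elim: q => [|q IH]; first by rewrite /inv_sq_sum /odd_sum !big_geq // mul0r addr0.
rewrite doubleS !inv_sq_sumS IH.
have -> : odd_sum q.+1 = odd_sum q + q.*2.+1%:R ^- 2 by rewrite /odd_sum big_nat_recr.
have -> : q.*2.+2%:R = 2 * q.+1%:R :> R by rewrite -natrM; congr _%:R; lia.
have := ltr0Sn R q => /lt0r_neq0; have := ltr0Sn R q.*2 => /lt0r_neq0.
by move: q.*2.+1%:R q.+1%:R => a b a0 b0; field; rewrite a0 b0.
Qed.

(** At a power of two, [inv_sq_sum_double] gives 3/4 of the sum as [odd_sum] minus a small tail; the
    constant 6 leaves room. Other q follow by monotonicity and the tail bound, letting j grow. *)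
Lemma basel q : (0 < q)%N -> inv_sq_sum q <= pi ^+ 2 / 6 <= inv_sq_sum q + q%:R^-1.
Proof.
move=> q0; have dyadic j : inv_sq_sum (2 ^ j) <= pi ^+ 2 / 6 <= inv_sq_sum (2 ^ j) + 6 / (2 ^ j)%:R.
  have /andP[L U] := odd_sum_bounds j.
  have Q0 : (0 < 2 ^ j)%N by rewrite expn_gt0.
  have := inv_sq_sum_double (2 ^ j).
  have le2 : (2 ^ j <= (2 ^ j).*2)%N by lia.
  rewrite (inv_sq_sum_cat le2).
  have T0 : 0 <= \sum_((2 ^ j).+1 <= k < (2 ^ j).*2.+1) k%:R ^- 2 :> R.
    by rewrite sumr_ge0 // => k _; rewrite invr_ge0 exprn_ge0.
  have T1 := inv_sq_tail Q0 le2.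
  have T2 : 0 <= (2 ^ j).*2%:R^-1 :> R by rewrite invr_ge0.
  have p4 : pi ^+ 2 <= 16 :> R.
    have -> : 16 = 4 ^+ 2 :> R by rewrite -natrX.
    rewrite lerXn2r ?nnegrE ?pi_ge0 //.
    by have := pihalf_lt2 R; lra.
  have T3 : pi ^+ 2 / (16 * 2 ^+ j) <= (2 ^ j)%:R^-1 :> R.
    rewrite natrX invfM mulrA ler_piMl ?invr_ge0 ?exprn_ge0 //.
    by rewrite ler_pdivrMr // mul1r.
  move: T0 T1 T2 T3 L U; move: (\sum_(_ <= _ < _) _) (inv_sq_sum _) (odd_sum _).
  move=> t h o T0 T1 T2 T3 L U e; apply/andP; split; lra.
apply/andP; split.
  have /andP[h _] := dyadic q; apply: le_trans h.
  by apply: inv_sq_sum_le; rewrite ltnW // ltn_expl.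
apply: (@le_archi _ _ 6) => j; have /andP[_ h] := dyadic (q + j)%N; apply: le_trans h _.
have qQ : (q <= 2 ^ (q + j))%N by rewrite ltnW // (leq_ltn_trans (leq_addr j q)) // ltn_expl.
rewrite (inv_sq_sum_cat qQ) lerD //.
  rewrite lerD2l; apply: le_trans (inv_sq_tail q0 qQ) _.
  by rewrite gerBl invr_ge0.
rewrite ler_pM2l // lef_pV2 ?posrE ?ltr0n ?expn_gt0 // ler_nat.
by apply: leq_trans (ltn_expl (q + j) (isT : (1 < 2)%N)); lia.
Qed.

End Basel.

(** * The Moebius function *)

Lemma sum_multiples (V : nmodType) (h : nat -> V) d M : (0 < d)%N ->
  \sum_(1 <= i < M.+1 | (d %| i)%N) h i = \sum_(1 <= l < (M %/ d).+1) h (d * l)%N.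
Proof.
move=> d0; elim: M => [|M IH]; first by rewrite div0n !big_geq.
rewrite big_mkcond big_nat_recr //= -big_mkcond IH divnS //.
case: ifP => dM; last by rewrite add0n addr0.
rewrite add1n [RHS]big_nat_recr //=; congr (_ + h _).
have := divnS M d0; rewrite dM add1n => <-; by rewrite mulnC divnK.
Qed.

Definition squarefree (k : nat) : bool := ~~ has (fun p => p ^ 2 %| k)%N (primes k).

Definition mobius (R : realType) (k : nat) : R :=
  if squarefree k then (-1) ^+ size (primes k) else 0.

Section Mobius.

Variable R : realType.
Local Notation mu := (mobius R).

Lemma mobius_le1 k : `|mu k| <= 1.
Proof. by rewrite /mobius; case: ifP => _; rewrite ?normrX ?normrN1 ?expr1n ?normr0. Qed.

Lemma mobius1 : mu 1 = 1.
Proof. by rewrite /mobius /squarefree /= expr0. Qed.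

Lemma mobius_sq p e : prime p -> (0 < e)%N -> (p %| e)%N -> mu (p * e) = 0.
Proof.
move=> pp e0 pe; rewrite /mobius ifN // negbK; apply/hasP; exists p.
  by rewrite mem_primes pp muln_gt0 prime_gt0 // e0 dvdn_mulr.
by rewrite dvdn_pmul2l ?prime_gt0.
Qed.

Lemma mobius_mul p e : prime p -> (0 < e)%N -> ~~ (p %| e)%N -> mu (p * e) = - mu e.
Proof.
move=> pp e0 pe; have p0 := prime_gt0 pp.
have pr : perm_eq (primes (p * e)) (p :: primes e).
  apply: uniq_perm; rewrite ?primes_uniq //=.
    by rewrite primes_uniq andbT mem_primes (negbTE pe) !andbF.
  by move=> q; rewrite primesM // inE primes_prime // inE.
rewrite /mobius (perm_size pr) /= exprS mulN1r.
have -> : squarefree (p * e) = squarefree e; last by case: ifP; rewrite ?oppr0.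
rewrite /squarefree (perm_has _ pr) /=; congr (~~ _).
have -> : (p ^ 2 %| p * e)%N = false by rewrite dvdn_pmul2l // (negbTE pe).
apply: eq_in_has => q; rewrite mem_primes => /and3P[pq _ qe].
rewrite Gauss_dvdr // coprime_pexpl // prime_coprime // dvdn_prime2 //.
by apply/eqP => qp; rewrite -qp qe in pe.
Qed.

(** For a prime p dividing k, the terms of e and p e cancel when p does not divide e, and those of p
    e vanish otherwise. *)
Lemma sum_mobius k M : (0 < k <= M)%N ->
  \sum_(1 <= d < M.+1 | (d %| k)%N) mu d = (k == 1%N)%:R.
Proof.
move=> /andP[k0 kM]; have [->|k1] := eqVneq k 1%N.
  rewrite big_mkcond big_nat_recl ?(leq_trans k0) //= mobius1 big1_seq ?addr0 //.
  move=> d; rewrite mem_index_iota => /andP[_ /andP[d0 _]].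
  by case: ifP => //; rewrite dvdn1 => /eqP[] e; rewrite e in d0.
have pp : prime (pdiv k) by apply: pdiv_prime; lia.
have pk := pdiv_dvd k; move: (pdiv k) pp pk => p pp pk; have p0 := prime_gt0 pp.
rewrite (bigID (fun d => p %| d)%N) /=.
have -> : \sum_(1 <= d < M.+1 | (d %| k)%N && (p %| d)%N) mu d =
    \sum_(1 <= e < (M %/ p).+1) (if (p * e %| k)%N then mu (p * e) else 0).
  rewrite -(sum_multiples (fun d => if (d %| k)%N then mu d else 0) M p0).
  rewrite big_mkcond [RHS]big_mkcond; apply: eq_bigr => d _.
  by case: (d %| k)%N; case: (p %| d)%N.
have -> : \sum_(1 <= e < (M %/ p).+1) (if (p * e %| k)%N then mu (p * e) else 0) =
    - \sum_(1 <= e < (M %/ p).+1) (if (e %| k)%N && ~~ (p %| e)%N then mu e else 0).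
  rewrite -sumrN; apply: eq_big_nat => e /andP[e0 _].
  have [pe|pe] := boolP (p %| e)%N.
    by rewrite andbF mobius_sq // oppr0 if_same.
  rewrite andbT Gauss_dvd ?prime_coprime // pk /=.
  by case: ifP; rewrite ?oppr0 // mobius_mul.
rewrite [X in - _ + X]big_mkcond /=.
(* Nothing remains beyond M / p: if e divides k and p does not divide e, then p e divides k, so p e
   <= M. *)
rewrite [X in - _ + X](big_cat_nat (n := (M %/ p).+1)) //=; last by rewrite ltnS leq_div.
rewrite addKr big_nat_cond big1 ?(negbTE k1) // => e /andP[/andP[e1 e2] _].
case: ifP => // /andP[ek pe]; exfalso.
have : (p * e <= M)%N.
  apply: leq_trans kM; apply: dvdn_leq => //.
  by rewrite Gauss_dvd ?prime_coprime // pk.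
by rewrite leqNgt mulnC -ltn_divLR // e1.
Qed.

Lemma mobius_inversion (c : nat -> R) M : (0 < M)%N ->
  \sum_(1 <= d < M.+1) mu d * (\sum_(1 <= l < (M %/ d).+1) c (d * l)%N) = c 1%N.
Proof.
move=> M0.
transitivity (\sum_(1 <= d < M.+1) \sum_(1 <= k < M.+1) (if (d %| k)%N then mu d * c k else 0)).
  apply: eq_big_nat => d /andP[d0 _].
  by rewrite -sum_multiples // big_distrr /= big_mkcond.
rewrite exchange_big /=.
transitivity (\sum_(1 <= k < M.+1) (k == 1%N)%:R * c k).
  apply: eq_big_nat => k kM; rewrite -big_mkcond -mulr_suml /=.
  by rewrite sum_mobius //; lia.
rewrite big_nat_recl //= mul1r big_nat_cond big1 ?addr0 // => k /andP[/andP[k0 _] _].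
by case: k k0 => // k _; rewrite mul0r.
Qed.

Lemma coprime_mobius i j M : (0 < i <= M)%N -> (0 < j)%N ->
  (coprime i j)%:R = \sum_(1 <= d < M.+1 | (d %| i)%N && (d %| j)%N) mu d.
Proof.
move=> /andP[i0 iM] j0; rewrite /coprime.
have -> : \sum_(1 <= d < M.+1 | (d %| i)%N && (d %| j)%N) mu d =
    \sum_(1 <= d < M.+1 | (d %| gcdn i j)%N) mu d.
  by apply: eq_bigl => d; rewrite dvdn_gcd.
rewrite sum_mobius // gcdn_gt0 i0 /=.
by apply: leq_trans iM; apply: dvdn_leq => //; exact: dvdn_gcdl.
Qed.

(** Inversion of the constant 1 gives that mu(d) floor(M/d) sums to 1; replacing each floor by M/d
    costs at most M in all. *)
Lemma mobius_harmonic_le M : (0 < M)%N -> `|\sum_(1 <= d < M.+1) mu d / d%:R| <= 2.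
Proof.
move=> M0; have M0' : 0 < M%:R :> R by rewrite ltr0n.
have := mobius_inversion (fun=> 1) M0.
under eq_bigr => d _ do rewrite big_const_nat subn1 /= iter_addr addr0.
move=> e; rewrite -(ler_pM2l M0') -{1}(gtr0_norm M0') -normrM.
have -> : M%:R * (\sum_(1 <= d < M.+1) mu d / d%:R) =
    1 + \sum_(1 <= d < M.+1) mu d * (M%:R / d%:R - (M %/ d)%:R).
  rewrite -[X in X + _]e -big_split big_distrr /=; apply: eq_bigr => d _.
  by rewrite mulrBr addrC subrK mulrCA.
apply: le_trans (ler_normD _ _) _; rewrite normr1.
have : `|\sum_(1 <= d < M.+1) mu d * (M%:R / d%:R - (M %/ d)%:R)| <= M%:R.
  apply: le_trans (ler_norm_sum _ _ _) _.
  apply: (@le_trans _ _ (\sum_(1 <= d < M.+1) 1)).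
    2: by rewrite big_const_nat subn1 /= iter_addr addr0.
  apply: ler_sum_nat => d /andP[d0 _]; rewrite normrM; apply: mulr_ile1; rewrite ?normr_ge0 ?mobius_le1 //.
  have d0' : 0 < d%:R :> R by rewrite ltr0n.
  have E : M%:R / d%:R - (M %/ d)%:R = (M %% d)%:R / d%:R :> R.
    rewrite {1}(divn_eq M d) natrD natrM; field; by rewrite gt_eqF.
  by rewrite E ger0_norm ?divr_ge0 // ler_pdivrMr // mul1r ler_nat ltnW // ltn_mod.
have : 1 <= M%:R :> R by rewrite ler1n.
by move=> h1 h2; lra.
Qed.

Definition mobius_sq_sum (M : nat) : R := \sum_(1 <= d < M.+1) mu d / d%:R ^+ 2.

Lemma mobius_sq_sum_cauchy M K : (0 < M)%N -> (M <= K)%N ->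
  `|mobius_sq_sum K - mobius_sq_sum M| <= M%:R^-1.
Proof.
move=> M0 MK; rewrite /mobius_sq_sum (big_cat_nat (n := M.+1)) //= addrAC subrr add0r.
apply: le_trans (ler_norm_sum _ _ _) _.
apply: (@le_trans _ _ (\sum_(M.+1 <= d < K.+1) d%:R ^- 2)).
  apply: ler_sum_nat => d _; rewrite normrM [X in _ * X]ger0_norm ?invr_ge0 ?exprn_ge0 //.
  by rewrite ler_piMl ?invr_ge0 ?exprn_ge0 // mobius_le1.
by apply: le_trans (inv_sq_tail R M0 MK) _; rewrite gerBl invr_ge0.
Qed.

(** Inversion of k^-2 expresses 1 through partial sums of zeta(2). Completing them costs at most
    2/(d K) for each d; with K = L^2 the sum of these is bounded without a logarithm. *)
Lemma mobius_sq_sum_zeta L : (0 < L)%N ->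
  `|pi ^+ 2 / 6 * mobius_sq_sum (L ^ 2) - 1| <= 3 / L%:R.
Proof.
move=> L0; have L0' : 0 < L%:R :> R by rewrite ltr0n.
have K0 : (0 < L ^ 2)%N by rewrite expn_gt0 L0.
set z : R := pi ^+ 2 / 6; set K := (L ^ 2)%N in K0 *.
have K0' : 0 < K%:R :> R by rewrite ltr0n.
have e := mobius_inversion (fun k => k%:R ^- 2) K0.
rewrite expr1n invr1 in e.
have -> : z * mobius_sq_sum K - 1 =
    \sum_(1 <= d < K.+1) mu d / d%:R ^+ 2 * (z - inv_sq_sum R (K %/ d)).
  rewrite -[X in _ - X]e /mobius_sq_sum big_distrr -sumrB /=; apply: eq_bigr => d _.
  have -> : \sum_(1 <= l < (K %/ d).+1) (d * l)%:R ^- 2 = d%:R ^- 2 * inv_sq_sum R (K %/ d).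
    by rewrite /inv_sq_sum big_distrr /=; apply: eq_bigr => l _; rewrite natrM exprMn invfM.
  by rewrite [z * _]mulrC [mu d * (_ * _)]mulrA -mulrBr.
apply: le_trans (ler_norm_sum _ _ _) _.
apply: (@le_trans _ _ (\sum_(1 <= d < K.+1) (L%:R / K%:R * d%:R ^- 2 + (L%:R * K%:R)^-1))).
  apply: ler_sum_nat => d /andP[d0 dK].
  have d0' : 0 < d%:R :> R by rewrite ltr0n.
  have q0 : (0 < K %/ d)%N by rewrite divn_gt0.
  have /andP[b1 b2] := basel R q0; rewrite -/z in b1 b2.
  have q0' : 0 < (K %/ d)%:R :> R by rewrite ltr0n.
  have b3 : (K %/ d)%:R^-1 <= 2 * d%:R / K%:R :> R.
    rewrite -[X in X <= _]mul1r ler_pdivrMr // mulrAC ler_pdivlMr // mul1r -!natrM ler_nat.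
    by have := ltn_ceil K d0; rewrite mulSn; move: q0; nia.
  have d2 : 0 <= d%:R ^- 2 :> R by rewrite invr_ge0 exprn_ge0.
  rewrite normrM normrM (ger0_norm d2) (ger0_norm (x := z - _)) ?subr_ge0 //.
  apply: (@le_trans _ _ (d%:R ^- 2 * (2 * d%:R / K%:R))).
    rewrite ler_pM ?mulr_ge0 ?subr_ge0 //; last by lra.
    by rewrite ler_piMl // mobius_le1.
  have E : d%:R ^- 2 * (2 * d%:R / K%:R) = 2 * d%:R^-1 / K%:R :> R.
    by field; rewrite !gt_eqF.
  have -> : L%:R / K%:R * d%:R ^- 2 + (L%:R * K%:R)^-1 =
      (L%:R * d%:R ^- 2 + L%:R^-1) / K%:R :> R by field; rewrite !gt_eqF.
  rewrite E ler_pM2r ?invr_gt0 //.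
  (* AM-GM: [2 / d <= L / d ^ 2 + 1 / L] *)
  have : 0 <= L%:R * (d%:R^-1 - L%:R^-1) ^+ 2 :> R by rewrite mulr_ge0 ?sqr_ge0 // ltW.
  have -> : L%:R * (d%:R^-1 - L%:R^-1) ^+ 2 = L%:R * d%:R ^- 2 + L%:R^-1 - 2 * d%:R^-1 :> R.
    by field; rewrite !gt_eqF.
  by rewrite subr_ge0.
rewrite big_split -big_distrr /= -/(inv_sq_sum R K) big_const_nat subn1 /= iter_addr addr0.
have h2 : inv_sq_sum R K <= 2.
  rewrite (inv_sq_sum_cat R K0).
  have := inv_sq_tail R (isT : (0 < 1)%N) K0; rewrite invr1.
  have -> : inv_sq_sum R 1 = 1 by rewrite /inv_sq_sum big_nat1 expr1n invr1.
  have : 0 <= K%:R^-1 :> R by rewrite invr_ge0.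
  by lra.
have eK : K%:R = L%:R ^+ 2 :> R by rewrite natrX.
apply: (@le_trans _ _ (L%:R / K%:R * 2 + (L%:R * K%:R)^-1 *+ K)).
  by rewrite lerD2r ler_pM2l // divr_gt0.
rewrite -[(_ * _)^-1 *+ K]mulr_natr eK le_eqVlt; apply/orP; left; apply/eqP.
by field; rewrite gt_eqF.
Qed.

(** Let L grow in [mobius_sq_sum_zeta], comparing with the fixed M by the Cauchy bound. *)
Lemma mobius_sq_sum_limit M : (0 < M)%N -> `|mobius_sq_sum M - 6 / pi ^+ 2| <= M%:R^-1.
Proof.
move=> M0; have p0 := pi_gt0 R; set z : R := pi ^+ 2 / 6.
have z0 : 0 < z by rewrite divr_gt0 ?exprn_gt0.
have h : `|z * mobius_sq_sum M - 1| <= z * M%:R^-1.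
  apply: (@le_archi _ _ _ 3) => j; pose L := (j.+1 + M)%N.
  have L0 : (0 < L)%N by rewrite /L.
  have ML : (M <= L ^ 2)%N by rewrite /L expnS expn1; nia.
  have -> : z * mobius_sq_sum M - 1 = (z * mobius_sq_sum (L ^ 2) - 1) -
      z * (mobius_sq_sum (L ^ 2) - mobius_sq_sum M) by ring.
  apply: le_trans (ler_normB _ _) _; rewrite addrC lerD //.
    by rewrite normrM gtr0_norm // ler_pM2l // mobius_sq_sum_cauchy.
  apply: le_trans (mobius_sq_sum_zeta L0) _.
  by rewrite ler_pM2l // lef_pV2 ?posrE ?ltr0n // ler_nat /L leq_addr.
rewrite -(ler_pM2l z0) -{1}(gtr0_norm z0) -normrM mulrBr.
have -> : z * (6 / pi ^+ 2) = 1; last by [].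
by rewrite /z; move: (lt0r_neq0 p0); move: (pi : R) => p pn; field.
Qed.

End Mobius.

(** * Asymptotics *)

Lemma sum_abs_ord (h : nat -> nat) m :
  (\sum_(i < m.*2.+1) h `|(i : nat)%:Z - m%:Z|%N = h 0 + 2 * \sum_(1 <= i < m.+1) h i)%N.
Proof.
rewrite -(big_mkord predT (fun i => h `|i%:Z - m%:Z|%N)) /=.
rewrite (big_cat_nat (n := m)) //=; last by lia.
rewrite [X in (_ + X)%N]big_ltn; last by lia.
rewrite subrr absz0.
have -> : (\sum_(0 <= i < m) h `|i%:Z - m%:Z| = \sum_(1 <= i < m.+1) h i)%N.
  rewrite big_nat_rev /= big_add1 /=; apply: eq_big_nat => i im.
  by congr h; lia.
have -> : (\sum_(m.+1 <= i < m.*2.+1) h `|i%:Z - m%:Z| = \sum_(1 <= i < m.+1) h i)%N.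
  rewrite -{1}[m.+1]add1n big_addn; have -> : (m.*2.+1 - m = m.+1)%N by lia.
  by apply: eq_big_nat => i _; congr h; lia.
by lia.
Qed.

Section Asymptotics.

Variable R : realType.

Definition prim_term (m n i j : nat) : nat :=
  (coprime i j * ((m - 2 * i) * (n - 2 * j)))%N.

Definition prim_sum (m n : nat) : nat :=
  (\sum_(1 <= i < m.+1) \sum_(1 <= j < n.+1) prim_term m n i j)%N.

(** Four open quadrants contribute equally. On the axes only the four unit vectors are primitive,
    each contributing at most m n. *)
Lemma sum_bidirs_prim_sum m n : (0 < m)%N -> (0 < n)%N ->
  (4 * prim_sum m n <= \sum_(z : 'I_m * 'I_n) #|bidirs z| <= 4 * prim_sum m n + 4 * (m * n))%N.
Proof.
move=> m0 n0; rewrite sum_bidirs.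
have -> : (\sum_(t in short_dirs m n) (m - 2 * `|(vec t).1|) * (n - 2 * `|(vec t).2|) =
    \sum_(i < m.*2.+1) \sum_(j < n.*2.+1)
      prim_term m n `|(i : nat)%:Z - m%:Z| `|(j : nat)%:Z - n%:Z|)%N.
  rewrite big_mkcond pair_bigA; apply: eq_bigr => t _; rewrite mem_short_dirs /prim_term.
  rewrite /prim coprimezE [(vec t).1]/= [(vec t).2]/= /=.
  move: ((t.1 : nat)%:Z - m%:Z) ((t.2 : nat)%:Z - n%:Z) => a b.
  case: coprime; last by rewrite mul0n.
  rewrite mul1n /=; case: ifP => // h.
  have [->|->] : (m - 2 * `|a| = 0)%N \/ (n - 2 * `|b| = 0)%N by lia.
    by rewrite mul0n.
  by rewrite muln0.
under eq_bigr => i _ do rewrite sum_abs_ord.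
rewrite (sum_abs_ord (fun i => prim_term m n i 0 + 2 * \sum_(1 <= j < n.+1) prim_term m n i j)%N).
rewrite big_split /= -big_distrr /= -/(prim_sum m n).
have e0 : prim_term m n 0 0 = 0%N by rewrite /prim_term mul0n.
have e1 : (\sum_(1 <= j < n.+1) prim_term m n 0 j <= m * n)%N.
  rewrite big_ltn // big_nat_cond big1 ?addn0.
    by rewrite /prim_term; case: coprime; rewrite ?mul0n // mul1n; nia.
  by move=> j hj; rewrite /prim_term /coprime gcd0n; case: eqP; rewrite ?mul0n //; lia.
have e2 : (\sum_(1 <= i < m.+1) prim_term m n i 0 <= m * n)%N.
  rewrite big_ltn // big_nat_cond big1 ?addn0.
    by rewrite /prim_term; case: coprime; rewrite ?mul0n // mul1n; nia.
  by move=> j hj; rewrite /prim_term /coprime gcdn0; case: eqP; rewrite ?mul0n //; lia.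
rewrite e0; move: e1 e2.
move: (\sum_(1 <= j < n.+1) _)%N (\sum_(1 <= i < m.+1) prim_term _ _ i 0)%N (prim_sum m n) (m * n)%N.
by move=> a b c e; lia.
Qed.

Definition gap_sum (k d : nat) : R := \sum_(1 <= i < k.+1 | (d %| i)%N) (k - 2 * i)%N%:R.

Lemma prim_sum_mobius m n :
  (prim_sum m n)%:R = \sum_(1 <= d < m.+1) mobius R d * (gap_sum m d * gap_sum n d).
Proof.
rewrite /prim_sum natr_sum.
transitivity (\sum_(1 <= i < m.+1) \sum_(1 <= d < m.+1) \sum_(1 <= j < n.+1)
   (if (d %| i)%N && (d %| j)%N then
      mobius R d * ((m - 2 * i)%N%:R * (n - 2 * j)%N%:R) else 0)).
  apply: eq_big_nat => i hi; rewrite natr_sum exchange_big; apply: eq_big_nat => j hj.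
  rewrite /prim_term natrM (coprime_mobius R (M := m)); [|lia|lia].
  by rewrite big_mkcond mulr_suml natrM; apply: eq_bigr => d _; case: ifP; rewrite ?mul0r.
rewrite exchange_big; apply: eq_bigr => d _; rewrite /gap_sum.
rewrite big_distrlr big_distrr [RHS]big_mkcond; apply: eq_bigr => i _.
case: (d %| i)%N; last by rewrite big1 // => j _.
by rewrite big_distrr [RHS]big_mkcond; apply: eq_bigr => j _; case: (d %| j)%N.
Qed.

Lemma gap_sum_closed k d q : (2 * d * q <= k)%N ->
  \sum_(1 <= l < q.+1) (k - 2 * (d * l))%N%:R = q%:R * k%:R - d%:R * (q%:R * (q%:R + 1)) :> R.
Proof.
elim: q => [|q IH] h; first by rewrite big_geq // !mul0r mulr0 subr0.
rewrite big_nat_recr //= IH; last by nia.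
rewrite natrB; last by lia.
by rewrite !natrM -[q.+1%:R]natr1; ring.
Qed.

(** With r the remainder of k modulo 2d, the difference is exactly r (2d - r) / (4d), and r (2d - r)
    <= d^2. *)
Lemma gap_sum_bounds k d : (0 < d)%N ->
  0 <= gap_sum k d - (k%:R ^+ 2 / (4 * d%:R) - k%:R / 2) <= d%:R / 4.
Proof.
move=> d0; rewrite /gap_sum (sum_multiples (fun i => (k - 2 * i)%N%:R) k d0).
have d2 : (0 < 2 * d)%N by lia.
pose q := (k %/ (2 * d))%N; pose r := (k %% (2 * d))%N.
have ek : k = (q * (2 * d) + r)%N by rewrite /q /r -divn_eq.
have rd : (r < 2 * d)%N by rewrite ltn_mod.
have qk : (q <= k %/ d)%N by rewrite leq_divRL // ek; nia.
rewrite (big_cat_nat (n := q.+1)) //= gap_sum_closed; last by rewrite ek; nia.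
have -> : \sum_(q.+1 <= l < (k %/ d).+1) (k - 2 * (d * l))%N%:R = 0 :> R.
  rewrite big_nat_cond big1 // => l /andP[/andP[ql _] _].
  by have -> : (k - 2 * (d * l) = 0)%N by rewrite {1}ek; nia.
rewrite addr0.
have d0' : 0 < d%:R :> R by rewrite ltr0n.
have r0 : 0 <= r%:R :> R by [].
have rd' : r%:R <= 2 * d%:R :> R by rewrite -natrM ler_nat ltnW.
have -> : q%:R * k%:R - d%:R * (q%:R * (q%:R + 1)) - (k%:R ^+ 2 / (4 * d%:R) - k%:R / 2) =
   r%:R * (2 * d%:R - r%:R) / (4 * d%:R) :> R.
  by rewrite ek natrD !natrM; field; rewrite gt_eqF.
apply/andP; split.
  by rewrite divr_ge0 ?mulr_ge0 ?subr_ge0 // ltW.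
rewrite ler_pdivrMr; last by rewrite mulr_gt0.
have : 0 <= (r%:R - d%:R) ^+ 2 :> R by rewrite sqr_ge0.
by rewrite -subr_ge0 => h; rewrite -subr_ge0; move: h; congr (0 <= _); field.
Qed.

Lemma norm_sum_mobius_le (e : nat -> R) (B : R) M :
  (forall d, (0 < d <= M)%N -> `|e d| <= B) ->
  `|\sum_(1 <= d < M.+1) mobius R d * e d| <= M%:R * B.
Proof.
move=> eB; apply: le_trans (ler_norm_sum _ _ _) _.
apply: (@le_trans _ _ (\sum_(1 <= d < M.+1) B)); last first.
  by rewrite big_const_nat subn1 /= iter_addr addr0 mulr_natl.
apply: ler_sum_nat => d dM; rewrite normrM; apply: le_trans (eB d dM).
by rewrite ler_piMl // mobius_le1.
Qed.

(** The three main terms are the expansion of P Q; as d <= a <= b, the errors add up to at most 7/16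
    of b^2. *)
Lemma gap_product_error (a b d x y : R) : 0 < d -> d <= a -> a <= b ->
  0 <= x - (a ^+ 2 / (4 * d) - a / 2) <= d / 4 ->
  0 <= y - (b ^+ 2 / (4 * d) - b / 2) <= d / 4 ->
  `|x * y - (a ^+ 2 * b ^+ 2 / 16 / d ^+ 2 - a * b * (a + b) / 8 / d + a * b / 4)| <= b ^+ 2 / 2.
Proof.
move=> d0 da ab; set P := a ^+ 2 / (4 * d) - a / 2; set Q := b ^+ 2 / (4 * d) - b / 2.
have a0 : 0 < a := lt_le_trans d0 da; have b0 : 0 < b := lt_le_trans a0 ab.
have norm_main (c : R) : 0 < c -> `|c ^+ 2 / (4 * d) - c / 2| <= c ^+ 2 / (4 * d) + c / 2.
  move=> c0; apply: le_trans (ler_normB _ _) _; rewrite !ger0_norm //.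
    by rewrite divr_ge0 ?ltW.
  by rewrite divr_ge0 ?exprn_ge0 ?mulr_ge0 ?ltW.
have nP := norm_main a a0; have nQ := norm_main b b0; rewrite -/P -/Q in nP nQ.
have -> : a ^+ 2 * b ^+ 2 / 16 / d ^+ 2 - a * b * (a + b) / 8 / d + a * b / 4 = P * Q.
  by rewrite /P /Q; field; rewrite gt_eqF.
move=> /andP[h1 h2] /andP[h3 h4].
have -> : x * y - P * Q = (x - P) * Q + P * (y - Q) + (x - P) * (y - Q) by ring.
have n1 : `|x - P| <= d / 4 by rewrite ger0_norm.
have n2 : `|y - Q| <= d / 4 by rewrite ger0_norm.
have B1 : `|(x - P) * Q| <= b ^+ 2 / 16 + d * b / 8.
  rewrite normrM; apply: le_trans (ler_pM (normr_ge0 _) (normr_ge0 _) n1 nQ) _.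
  by rewrite le_eqVlt; apply/orP; left; apply/eqP; field; rewrite gt_eqF.
have B2 : `|P * (y - Q)| <= a ^+ 2 / 16 + d * a / 8.
  rewrite normrM; apply: le_trans (ler_pM (normr_ge0 _) (normr_ge0 _) nP n2) _.
  by rewrite le_eqVlt; apply/orP; left; apply/eqP; field; rewrite gt_eqF.
have B3 : `|(x - P) * (y - Q)| <= d / 4 * (d / 4).
  by rewrite normrM ler_pM.
have dlb : d <= b := le_trans da ab.
have db : d * b <= b * b by rewrite ler_pM2r.
have da' : d * a <= b * b by rewrite ler_pM ?(ltW d0) ?(ltW a0).
have aa : a * a <= b * b by rewrite ler_pM ?(ltW a0).
have dd : d * d <= b * b by rewrite ler_pM ?(ltW d0).
apply: le_trans (ler_normD _ _) _; apply: le_trans (lerD (ler_normD _ _) (lexx _)) _.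
have bb : 0 <= b * b by rewrite mulr_ge0 ?ltW.
by move: B1 B2 B3; rewrite !expr2 => B1 B2 B3; lra.
Qed.

(** Main terms in 1/d^2, 1/d and 1 are summed against mu. The first gives 6/pi^2, the second is
    bounded by [mobius_harmonic_le], and the third and the error are estimated trivially. *)
Lemma prim_sum_asymptotic m n : (0 < m)%N -> (m <= n)%N ->
  `|(prim_sum m n)%:R - 6 / pi ^+ 2 * (m%:R ^+ 2 * n%:R ^+ 2 / 16)| <= 2 * (m%:R * n%:R ^+ 2) :> R.
Proof.
move=> m0 mn; have a0 : 0 < m%:R :> R by rewrite ltr0n.
have ab : m%:R <= n%:R :> R by rewrite ler_nat.
have H3 d : (0 < d <= m)%N ->
    `|gap_sum m d * gap_sum n d - (m%:R ^+ 2 * n%:R ^+ 2 / 16 / d%:R ^+ 2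
     - m%:R * n%:R * (m%:R + n%:R) / 8 / d%:R + m%:R * n%:R / 4)| <= n%:R ^+ 2 / 2 :> R.
  move=> /andP[d0 dm].
  by apply: gap_product_error; rewrite ?ltr0n ?ler_nat //; exact: gap_sum_bounds.
have E3 := norm_sum_mobius_le H3.
have E2 : `|\sum_(1 <= d < m.+1) mobius R d * 1| <= m%:R * 1.
  by apply: (norm_sum_mobius_le (e := fun=> 1)) => d _; rewrite normr1.
have E1 := mobius_harmonic_le R m0; have E0 := mobius_sq_sum_limit R m0.
rewrite prim_sum_mobius; move: E0 E1 E2 E3.
set z := 6 / pi ^+ 2; set M2 := mobius_sq_sum R m; set M1 := \sum_(_ <= d < _) _ / _.
set M0 := \sum_(_ <= d < _) _ * 1; set Er := \sum_(_ <= d < _) _.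
move: ab a0; set a := m%:R; set b := n%:R => ab a0 E0 E1 E2 E3.
have -> : \sum_(1 <= d < m.+1) mobius R d * (gap_sum m d * gap_sum n d) =
    a ^+ 2 * b ^+ 2 / 16 * M2 - a * b * (a + b) / 8 * M1 + a * b / 4 * M0 + Er.
  rewrite /M2 /mobius_sq_sum /M1 /M0 /Er !big_distrr -sumrB -!big_split /=.
  by apply: eq_bigr => d _; ring.
have b0 : 0 < b := lt_le_trans a0 ab.
have F0 : `|a ^+ 2 * b ^+ 2 / 16 * (M2 - z)| <= a * b ^+ 2 / 16.
  rewrite normrM ger0_norm; last by rewrite divr_ge0 ?mulr_ge0 ?exprn_ge0 ?ltW.
  have -> : a * b ^+ 2 / 16 = a ^+ 2 * b ^+ 2 / 16 * a^-1 by field; rewrite gt_eqF.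
  by rewrite ler_pM2l // divr_gt0 ?mulr_gt0 ?exprn_gt0.
have a0' := ltW a0; have b0' := ltW b0.
have c1 : 0 <= a * b * (a + b) / 8 by rewrite divr_ge0 ?mulr_ge0 ?addr_ge0.
have c2 : 0 <= a * b / 4 by rewrite divr_ge0 ?mulr_ge0.
have F1 : `|a * b * (a + b) / 8 * M1| <= a * b ^+ 2 / 2.
  rewrite normrM ger0_norm //.
  apply: (@le_trans _ _ (a * b * (a + b) / 8 * 2)).
    by rewrite ler_wpM2l.
  have h : a * b * (a + b) <= a * b * (b + b) by rewrite ler_wpM2l ?lerD // mulr_ge0 // ltW.
  by rewrite expr2; lra.
have F2 : `|a * b / 4 * M0| <= a * b ^+ 2 / 4.
  rewrite normrM ger0_norm //.
  apply: (@le_trans _ _ (a * b / 4 * (a * 1))).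
    by rewrite ler_wpM2l.
  have h : a * b * a <= a * b * b by rewrite ler_wpM2l // mulr_ge0 // ltW.
  by rewrite expr2; lra.
have -> : a ^+ 2 * b ^+ 2 / 16 * M2 - a * b * (a + b) / 8 * M1 + a * b / 4 * M0 + Er -
    z * (a ^+ 2 * b ^+ 2 / 16) =
    a ^+ 2 * b ^+ 2 / 16 * (M2 - z) - a * b * (a + b) / 8 * M1 + a * b / 4 * M0 + Er by ring.
apply: le_trans (ler_normD _ _) _; apply: le_trans (lerD (ler_normD _ _) (lexx _)) _.
apply: le_trans (lerD (lerD (ler_normB _ _) (lexx _)) (lexx _)) _.
have h : 0 <= a * b ^+ 2 by rewrite mulr_ge0 ?exprn_ge0 ?ltW.
by lra.
Qed.

End Asymptotics.

(** * Exact formulas and the final estimate *)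

Lemma s_le m n : (s m n <= m * n)%N.
Proof. by apply: leq_trans (max_card _) _; rewrite card_prod !card_ord. Qed.

Section Formulas.

Variables (R : realType) (m n : nat).
Hypotheses (m2 : (2 <= m)%N) (n2 : (2 <= n)%N).

Local Notation N := (\sum_(z : 'I_m * 'I_n) #|bidirs z|)%N.

Lemma u_false_oneE : (u R m n false 1)%:R = N%:R / 2 + 2 - (s m n)%:R :> R.
Proof.
have /(congr1 (fun k : nat => k%:R : R)) := u_false_one R m2 n2.
by rewrite !natrD => h; lra.
Qed.

Lemma u_true_oneE : (u R m n true 1)%:R = N%:R / 2 + 2 + (s m n)%:R :> R.
Proof.
have /(congr1 (fun k : nat => k%:R : R)) := u_true_one R m2 n2.
by rewrite !natrD => h; lra.
Qed.

Lemma u_true_two : u R m n true 2 = u R m n false 1.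
Proof. exact: (@u_compl R m n false 1). Qed.

Lemma u_false_two : u R m n false 2 = u R m n true 1.
Proof. exact: (@u_compl R m n true 1). Qed.

Lemma u_asymptotic nu kappa : kappa = 1%N \/ kappa = 2%N ->
  `|(u R m n nu kappa)%:R - N%:R / 2| <= 2 + (m * n)%:R :> R.
Proof.
have sb : (s m n)%:R <= (m * n)%:R :> R by rewrite ler_nat s_le.
have s0 : 0 <= (s m n)%:R :> R by [].
by case: nu => -[] ->; rewrite ?u_true_two ?u_false_two ?u_true_oneE ?u_false_oneE ler_norml;
   apply/andP; split; lra.
Qed.

End Formulas.

Lemma sum_bidirs_asymptotic (R : realType) m n : (0 < m)%N -> (m <= n)%N ->
  `|(\sum_(z : 'I_m * 'I_n) #|bidirs z|)%:R / 2 - 3 / (4 * pi ^+ 2) * (m%:R * n%:R) ^+ 2|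
    <= 4 * (m%:R * n%:R ^+ 2) + 2 * (m * n)%:R :> R.
Proof.
move=> m0 mn; have n0 := leq_trans m0 mn.
have /andP[] := sum_bidirs_prim_sum m0 n0.
rewrite -!(ler_nat R) natrD ![(4 * _)%:R]natrM => l1 l2.
have := prim_sum_asymptotic R m0 mn; rewrite ler_norml => /andP[h1 h2].
have E : 3 / (4 * pi ^+ 2) * (m%:R * n%:R) ^+ 2 =
    2 * (6 / pi ^+ 2 * (m%:R ^+ 2 * n%:R ^+ 2 / 16)) :> R.
  by move: (lt0r_neq0 (pi_gt0 R)); move: (pi : R) => p p0; field.
by rewrite ler_norml E; apply/andP; split; lra.
Qed.

Theorem theorem4 (R : realType) :
  (forall m n : nat, (2 <= m)%N -> (2 <= n)%N ->
    [/\ (u R m n false 1)%:R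
          = 2 * f 1 (m%:R / 2 : R) (n%:R / 2) + 2 - (s m n)%:R,
        (u R m n true 2)%:R
          = 2 * f 1 (m%:R / 2 : R) (n%:R / 2) + 2 - (s m n)%:R,
        (u R m n false 2)%:R
          = f 2 (m%:R : R) n%:R + 2 - 2 * f 1 (m%:R / 2 : R) (n%:R / 2)
            + (s m n)%:R &
        (u R m n true 1)%:R
          = f 2 (m%:R : R) n%:R + 2 - 2 * f 1 (m%:R / 2 : R) (n%:R / 2)
            + (s m n)%:R])
  /\
  (exists C : R, forall (nu : bool) (kappa m n : nat),
    kappa = 1%N \/ kappa = 2%N -> (2 <= m)%N -> (m <= n)%N ->
    `|(u R m n nu kappa)%:R - 3 / (4 * pi ^+ 2) * (m%:R * n%:R) ^+ 2|
      <= C * (m%:R * n%:R ^+ 2)).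
Proof.
split=> [m n m2 n2|].
  have h1 := f_one_half R m n; have h2 := f_two R m n.
  rewrite u_true_two u_false_two u_false_oneE // u_true_oneE // h2.
  by split; lra.
(* With 2 and m n both at most m n^2, the errors add up to 1 + 1 + 4 + 2 = 8. *)
exists 8 => nu kappa m n hk m2 mn.
have n2 := leq_trans m2 mn.
have h1 := u_asymptotic R m2 n2 nu hk.
have h2 := sum_bidirs_asymptotic R (ltnW m2) mn.
have mnn : (m * n)%:R <= m%:R * n%:R ^+ 2 :> R.
  by rewrite -natrX -natrM ler_nat; nia.
have one : 2 <= m%:R * n%:R ^+ 2 :> R.
  by rewrite -natrX -natrM ler_nat; nia.
apply: le_trans (ler_distD ((\sum_(z : 'I_m * 'I_n) #|bidirs z|)%:R / 2) _ _) _.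
by apply: le_trans (lerD h1 h2) _; lra.
Qed.
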